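(* There exist absolute constants $C,c>0$ such that the following holds. Let $n\ge 1$ and $1\le m\le N$ be integers, let $1\le r\le 2$, and let $X_1,\dots,X_N\in\mathbb{R}^n$ be independent $\psi_r$ random vectors with $\psi=\max_{i\le N}\|X_i\|_{\psi_r}$. Let $\theta\in(0,1/4)$ and $K,K'\ge 1$, and assume that $m$ satisfies $$ m\log^{2/r}\frac{2N}{\theta m}\le \theta^2 n. $$ Set $\xi=\psi K+K'$ and $$ B_m=\sup_{z\in U_m}\left|\,\Bigl|\sum_{i\le N}z_iX_i\Bigr|^2-\sum_{i\le N}z_i^2|X_i|^2\right|^{1/2}. $$ Then the inequality $$ B_m^2\le C\xi^2\theta n $$ holds with probability at least $$ 1-\exp\left(-cK^r\sqrt m\,\log\left(\frac{2N}{\theta m}\right)\right)-\mathbb{P}\left(\max_{i\le N}|X_i|\ge K'\sqrt n\right). $$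
   Context: $|\cdot|$ is the Euclidean norm on $\mathbb{R}^n$ and $\mathbb{R}^N$ and $\langle\cdot,\cdot\rangle$ the standard scalar product; $S^{n-1}$ is the Euclidean unit sphere of $\mathbb{R}^n$. $U_m=\{z\in\mathbb{R}^N: |z|=1,\ |\operatorname{supp} z|\le m\}$ is the set of unit vectors having at most $m$ non-zero coordinates. For a real random variable $Y$ and $r>0$, $\|Y\|_{\psi_r}=\inf\{C>0:\ \mathbb{E}\exp((|Y|/C)^r)\le 2\}$. A random vector $X\in\mathbb{R}^n$ is called a $\psi_r$ vector if it is centered ($\mathbb{E}X=0$) and $\|X\|_{\psi_r}:=\sup_{y\in S^{n-1}}\|\langle X,y\rangle\|_{\psi_r}<\infty$. *)

(* Defs.v *)
From HB Require Import structures.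
From mathcomp Require Export all_boot all_order all_algebra.
From mathcomp Require Export all_classical all_reals all_analysis.
Export Order.TTheory GRing.Theory Num.Theory numFieldNormedType.Exports.

Set Implicit Arguments.
Unset Strict Implicit.
Unset Printing Implicit Defensive.

Local Open Scope classical_set_scope.
Local Open Scope ring_scope.

Section Euclidean.
Context {R : realType}.

Definition dotp n (x y : 'rV[R]_n) : R := \sum_(j < n) x 0 j * y 0 j.

(* The library norm `|x| on 'rV[R]_n is the sup norm. *)
Definition enorm n (x : 'rV[R]_n) : R := Num.sqrt (dotp x x).

Definition sphere n : set 'rV[R]_n := [set y | enorm y = 1].

Definition supp n (z : 'rV[R]_n) : {pred 'I_n} := [pred i | z 0 i != 0].

Definition sparse_sphere N m : set 'rV[R]_N :=
  [set z | enorm z = 1 /\ (#|supp z| <= m)%N].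

(* Random vectors take values in n.-tuple R, which carries the product
   (i.e. Borel) sigma-algebra in the library; linear algebra takes place in
   'rV[R]_n. *)
Definition tuple_row n (t : n.-tuple R) : 'rV[R]_n := \row_j tnth t j.

End Euclidean.

Section Probability.
Context d {T : measurableType d} {R : realType} (P : probability T R).

Definition independent_RV d' (T' : measurableType d') N
    (X : 'I_N -> {RV P >-> T'}) : Prop :=
  forall (J : {set 'I_N}) (A : 'I_N -> set T'),
    (forall i, measurable (A i)) ->
    P (\bigcap_(i in [set` J]) (X i @^-1` A i))
    = (\prod_(i in J) P (X i @^-1` A i))%E.

Definition psi_norm (r : R) (Y : T -> R) : \bar R :=
  ereal_inf [set C%:E | C in
    [set C : R | 0 < C /\
       ('E_P[fun w => expR ((`|Y w| / C) `^ r)] <= 2%:E)%E]].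

Definition psi_vnorm n (r : R) (X : T -> 'rV[R]_n) : \bar R :=
  ereal_sup [set psi_norm r (fun w => dotp (X w) y) | y in @sphere R n].

(* The library's integral of an X_j with both parts infinite is -oo, so the
   first clause includes the integrability of every coordinate. *)
Definition psi_vector n (r : R) (X : T -> 'rV[R]_n) : Prop :=
  (forall j, 'E_P[fun w => X w ord0 j] = 0)%E /\ (psi_vnorm r X < +oo)%E.

End Probability.

(* For 1 <= m <= N the supremum is over a nonempty bounded set of reals. *)
Definition B_ {R : realType} n N (m : nat) (x : 'I_N -> 'rV[R]_n) : R :=
  sup [set Num.sqrt `|enorm (\sum_(i < N) z 0 i *: x i) ^+ 2
                      - \sum_(i < N) z 0 i ^+ 2 * enorm (x i) ^+ 2|
      | z in @sparse_sphere R N m].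

(* Main.v *)
(* The sum over i <> j is decoupled: it is at most 4 times the largest
   <X z_I, X z_J> over the partitions (I, J) of the index set, where
   X u = sum_i u_i X_i.  The entries of z are sorted into levels
   |z_i| ~ 4^k / sqrt m, with about m / 16^k entries each, for 64^k <= m; the
   larger entries form one last level.  Telescoping over the levels leaves
   terms <X u, X v> with u, v disjointly supported on at most m / 16^k indices,
   and with entries of u of order 4^k / sqrt m, except on the last level.

   Conditionally on X v, <X u, X v> / |X v| is a sum of independent centered
   psi_r variables, so it exceeds psi M / al with probability at most
   2 exp(- M^r / (512 al^2)) if |u| <= 1 and max_i |u_i| <= al.  With
   M ~ K L^(1/r) 2^k, where L = ln (2N / (theta m)), this beats the cardinality
   of a net of accuracy 1/2, and the terms M / al sum up geometrically to
   K L^(1/r) sqrt m <= K theta sqrt n.  Since |X v|^2 <= max_i |X_i|^2 + B_m^2,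
   the outcome is an inequality B_m^2 <= c (K'^2 n + B_m^2)^(1/2) with
   c ~ psi K theta sqrt n, which is solved for B_m^2. *)
From HB Require Import structures.
Require Import Defs.
From mathcomp Require Import measurable_realfun ring lra.

Set Implicit Arguments.
Unset Strict Implicit.
Unset Printing Implicit Defensive.

Local Open Scope classical_set_scope.
Local Open Scope ring_scope.

(** * Moment generating functions of psi_r variables *)

(** The growth [2^k] of [M] is chosen between two demands. With [al = 4^k / sqrt m], the terms
    [M / al] decrease like [sqrt m / 2^k], while for every [r >= 1] the exponent [M^r / al^2] is at
    least of order [K^r L 2^k m / 16^k = K^r L m / 8^k]. The entropy of level [k] is of order
    [(m / 16^k) (L + k)], and the spare factor [2^k] absorbs [k]. Stopping at [64^k <= m] keeps
    [m / 8^k >= sqrt m], which is the origin of [sqrt m] in the probability. The larger entries are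
    few enough that one level with [al = 1] and [M ~ K L^(1/r) sqrt m] has entropy of order at most
    [L sqrt m] and an exponent that beats it.

    An obstacle is that a psi_r variable with [r < 2] need not be sub-Gaussian. At scale 1, its
    moment generating function at [mu] is still at most [exp(128 mu^2 M^(2-r))] as long as
    [|mu| <= M^(r-1)]. The Chernoff bound at level [M / al] uses a parameter of order
    [M^(r-1) / al], so the bound [al] on the entries of [u] keeps each coefficient in this range. *)

Section Scalar.
Context {R : realType}.
Implicit Types x y : R.

Lemma expR1_le4 : expR 1 <= 4 :> R.
Proof.
have h : expR (2^-1 : R) <= 2.
  have := expR_ge1Dx (- 2^-1 : R); rewrite expRN => h.
  have e0 := expR_gt0 (2^-1 : R).
  rewrite -[leLHS]invrK -[leRHS]invrK lef_pV2 ?posrE ?invr_gt0//.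
  by apply: le_trans h; lra.
have -> : expR 1 = expR 2^-1 * expR 2^-1 :> R by rewrite -expRD; congr expR; lra.
have -> : 4 = 2 * 2 :> R by lra.
by rewrite ler_pM ?expR_ge0.
Qed.

(** [1 - x <= expR (- x)] rearranges to [expR x - 1 <= x * expR x] for either sign. For [x >= 0]
    this is used twice; for [x < 0] the factor [expR x] on the right is replaced by the smaller
    [1 + x]. *)
Lemma expR_le_taylor2 x : expR x <= 1 + x + x ^+ 2 * expR `|x|.
Proof.
have a : expR x - 1 <= x * expR x.
  have := expR_ge1Dx (- x); rewrite expRN.
  rewrite -(ler_pM2r (expR_gt0 x)) mulVf ?gt_eqF ?expR_gt0// => h; nra.
have [x0|x0] := leP 0 x.
  rewrite ger0_norm//.
  have : x * (expR x - 1) <= x * (x * expR x) by rewrite ler_wpM2l.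
  nra.
have e1 : 1 <= expR `|x| by rewrite -[1]expR0 ler_expR.
have := expR_ge1Dx x; nra.
Qed.

Lemma sqr_le_expR_half y : 0 <= y -> y ^+ 2 <= 16 * expR (y / 2).
Proof.
move=> y0; have h : y / 4 <= expR (y / 4) by have := expR_ge1Dx (y / 4); lra.
have -> : y / 2 = y / 4 + y / 4 by lra.
rewrite expRD; have : y / 4 * (y / 4) <= expR (y / 4) * expR (y / 4).
  by apply: ler_pM => //; lra.
nra.
Qed.

(** At most half of the exponent [|y|] is spent on [mu * y]; the other half absorbs [y ^ 2]. *)
Lemma expR_mul_le_taylor2 (mu y : R) : `|mu| <= 2^-1 ->
  expR (mu * y) <= 1 + mu * y + 16 * mu ^+ 2 * expR `|y|.
Proof.
move=> hmu; apply: (le_trans (expR_le_taylor2 _)).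
rewrite lerD2l exprMn.
apply: (@le_trans _ _ (mu ^+ 2 * (16 * expR `|y|))); last first.
  by rewrite mulrA [mu ^+ 2 * _]mulrC.
rewrite -[leLHS]mulrA ler_wpM2l ?sqr_ge0// -(real_normK (num_real y)).
have -> : expR `|y| = expR (`|y| / 2) * expR (`|y| / 2).
  by rewrite -expRD; congr expR; lra.
rewrite mulrA ler_pM ?sqr_ge0 ?expR_ge0 ?sqr_le_expR_half//.
by rewrite ler_expR normrM mulrC ler_wpM2l.
Qed.

(* AM-GM if [`|y| <= M]; otherwise [`|mu|] is at most [`|y| `^ (r - 1)]. *)
Lemma young_truncated (mu y M r : R) : 1 <= r -> r <= 2 -> 1 <= M ->
  `|mu| <= M `^ (r - 1) ->
  mu * y <= `|y| `^ r + mu ^+ 2 * M `^ (2 - r).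
Proof.
move=> r1 r2 M1 hmu; apply: (le_trans (ler_norm _)); rewrite normrM.
have M0 : 0 < M by lra.
have [yM|yM] := leP `|y| M; last first.
  apply: (@le_trans _ _ (`|y| `^ r)); last first.
    by rewrite lerDl mulr_ge0 ?sqr_ge0 ?powR_ge0.
  have y0 : 0 < `|y| by lra.
  have -> : `|y| `^ r = `|y| `^ (r - 1) * `|y|.
    by rewrite mulrC mulr_powRB1 ?normr_ge0 ?(lt_le_trans ltr01 r1).
  rewrite ler_wpM2r//; apply: (le_trans hmu).
  by apply: ge0_ler_powR; rewrite ?nnegrE; lra.
have [->|y0] := eqVneq y 0.
  rewrite normr0 mulr0; apply: addr_ge0; first exact: powR_ge0.
  by rewrite mulr_ge0 ?sqr_ge0 ?powR_ge0.
have ny : 0 < `|y| by rewrite normr_gt0.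
have P0 := powR_gt0 (2 - r) M0.
have h : `|y| ^+ 2 <= `|y| `^ r * M `^ (2 - r).
  have -> : `|y| ^+ 2 = `|y| `^ r * `|y| `^ (2 - r).
    rewrite -powR_mulrn ?normr_ge0// -powRD; first by congr (_ `^ _); lra.
    by apply/implyP => _; rewrite gt_eqF.
  by rewrite ler_wpM2l ?powR_ge0//; apply: ge0_ler_powR; rewrite ?nnegrE; lra.
set p := M `^ (2 - r) in P0 h *; set q := `|y| `^ r in h *.
rewrite -[mu ^+ 2]real_normK ?num_real//.
have : `|mu| * `|y| * p <= (q + `|mu| ^+ 2 * p) * p.
  have := sqr_ge0 (`|mu| * p - `|y|); nra.
by rewrite ler_pM2r.
Qed.

End Scalar.

Section PsiMgf.
Context d (T : measurableType d) (R : realType) (P : probability T R).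
Variables (Y : T -> R) (r : R).
Hypothesis mY : measurable_fun setT Y.
Hypotheses (r1 : 1 <= r) (r2 : r <= 2).
Hypothesis psiY : (\int[P]_w (expR (`|Y w| `^ r))%:E <= 2%:E)%E.

Let mexp_psi : measurable_fun setT (fun w => expR (`|Y w| `^ r)).
Proof.
apply: measurableT_comp => //.
apply: (measurableT_comp (measurable_powR _)).
by apply: measurableT_comp.
Qed.

Let mexp_abs : measurable_fun setT (fun w => expR `|Y w|).
Proof. by apply: measurableT_comp => //; apply: measurableT_comp. Qed.

(** [|y| <= 1 + |y|^r] for [r >= 1], and [8 = 4 * 2] with [expR 1 <= 4]. *)
Lemma integral_expR_abs_le : (\int[P]_w (expR `|Y w|)%:E <= 8%:E)%E.
Proof.
apply: (@le_trans _ _ (\int[P]_w (4%:E * (expR (`|Y w| `^ r))%:E))%E).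
  apply: ge0_le_integral => //.
  - exact/measurable_EFinP.
  - by apply/measurable_EFinP; apply: measurable_funM.
  - move=> x _; rewrite -EFinM lee_fin.
    apply: (@le_trans _ _ (expR (1 + `|Y x| `^ r))).
      rewrite ler_expR; have [y1|y1] := leP `|Y x| 1.
        by have := powR_ge0 `|Y x| r; lra.
      by have := le1r_powR (ltW y1) r1; lra.
    by rewrite expRD ler_wpM2r ?expR_ge0// expR1_le4.
rewrite ge0_integralZl//; first 1 last.
- exact/measurable_EFinP.
have -> : 8%:E = (4%:E * 2%:E)%E :> \bar R by rewrite -EFinM; congr EFin; lra.
by rewrite lee_pmul2l// lte_fin; lra.
Qed.

Lemma integrable_of_psi : P.-integrable setT (EFin \o Y).
Proof.
apply/integrableP; split; first exact/measurable_EFinP.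
apply: (@le_lt_trans _ _ (\int[P]_w (expR `|Y w|)%:E)%E); last first.
  by apply: (le_lt_trans integral_expR_abs_le); rewrite ltry.
apply: ge0_le_integral => //.
- by apply/measurable_EFinP; apply: measurableT_comp.
- exact/measurable_EFinP.
- by move=> x _ /=; rewrite lee_fin; have := expR_ge1Dx `|Y x|; lra.
Qed.

(** For [|mu| <= 1/2], centering removes the linear Taylor term and leaves [1 + 128 mu^2], with
    [128 = 16 * 8]. For larger [|mu|], [young_truncated] leaves a factor [2], which is at most
    [exp(4 mu^2 M^(2-r))] because [mu^2 >= 1/4]. *)
Lemma mgf_psi_le (M mu : R) : 1 <= M -> `|mu| <= M `^ (r - 1) ->
  (\int[P]_w (Y w)%:E = 0)%E ->
  (\int[P]_w (expR (mu * Y w))%:E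
     <= (expR (128 * mu ^+ 2 * M `^ (2 - r)))%:E)%E.
Proof.
move=> M1 hmu EY0; have M0 : 0 < M by lra.
have p1 : 1 <= M `^ (2 - r).
  have e0 : 0 <= 2 - r by rewrite subr_ge0.
  by have := ler_powR M1 e0; rewrite powRr0.
have mmu : measurable_fun setT (fun w => expR (mu * Y w)).
  by apply: measurableT_comp => //; apply: measurable_funM.
have [mu_small|mu_big] := leP `|mu| 2^-1.
  apply: (@le_trans _ _ (\int[P]_w ((1%:E + (mu%:E * (Y w)%:E))
                          + (16 * mu ^+ 2)%:E * (expR `|Y w|)%:E))%E).
    apply: ge0_le_integral => //.
    - exact/measurable_EFinP.
    - apply/measurable_EFinP => /=.
      by do ![apply: measurable_funD|apply: measurable_funM] => //.
    - by move=> x _; rewrite lee_fin expR_mul_le_taylor2.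
  have iY := integrable_of_psi.
  have ie : P.-integrable setT (EFin \o (fun w => expR `|Y w|)).
    apply/integrableP; split; first exact/measurable_EFinP.
    under eq_integral do rewrite /= ger0_norm ?expR_ge0//.
    by apply: (le_lt_trans integral_expR_abs_le); rewrite ltry.
  have i1 : P.-integrable setT (cst (1%:E : \bar R)).
    exact: finite_measure_integrable_cst.
  have iZ := integrableZl measurableT mu iY.
  have ieZ := integrableZl measurableT (16 * mu ^+ 2) ie.
  rewrite (integralD measurableT (integrableD measurableT i1 iZ) ieZ).
  rewrite (integralD measurableT i1 iZ).
  rewrite (integralZl measurableT iY) (integralZl measurableT ie).
  rewrite EY0 mule0 adde0 integral_cst//= probability_setT mule1.
  apply: (@le_trans _ _ (1 + (16 * mu ^+ 2)%:E * 8%:E)%E).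
    rewrite leeD2l// lee_wpmul2l ?integral_expR_abs_le// lee_fin.
    by have := sqr_ge0 mu; lra.
  rewrite -EFinM -EFinD lee_fin.
  have := expR_ge1Dx (128 * mu ^+ 2 * M `^ (2 - r)).
  apply: le_trans; have := sqr_ge0 mu; nra.
apply: (@le_trans _ _ (\int[P]_w ((expR (mu ^+ 2 * M `^ (2 - r)))%:E
                         * (expR (`|Y w| `^ r))%:E))%E).
  apply: ge0_le_integral => //.
  - exact/measurable_EFinP.
  - by apply/measurable_EFinP; apply: measurable_funM.
  - move=> x _; rewrite -EFinM lee_fin -expRD ler_expR addrC.
    exact: young_truncated.
rewrite ge0_integralZl//; first 1 last.
- exact/measurable_EFinP.
apply: (@le_trans _ _ ((expR (mu ^+ 2 * M `^ (2 - r)))%:E * 2%:E)%E).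
  by rewrite lee_wpmul2l ?lee_fin ?expR_ge0.
have hm : 4^-1 <= mu ^+ 2 by rewrite -(real_normK (num_real mu)); nra.
rewrite -EFinM lee_fin.
have two_le : 2 <= expR (4 * mu ^+ 2 * M `^ (2 - r)).
  by have := expR_ge1Dx (4 * mu ^+ 2 * M `^ (2 - r)); apply: le_trans; nra.
apply: (@le_trans _ _ (expR (mu ^+ 2 * M `^ (2 - r))
                       * expR (4 * mu ^+ 2 * M `^ (2 - r)))).
  by rewrite ler_wpM2l ?expR_ge0.
rewrite -expRD ler_expR; nra.
Qed.

End PsiMgf.

(** * Independence *)

Section TupleBoxes.
Context d (T : measurableType d) (N : nat).

(** A generating pi-system: finite measures on tuples need only be compared on these sets. *)
Definition tuple_boxes : set (set (N.-tuple T)) :=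
  [set B | exists2 F : 'I_N -> set T, (forall j, measurable (F j)) &
     B = [set t | forall j, F j (tnth t j)]].

Lemma setI_closed_tuple_boxes : setI_closed tuple_boxes.
Proof.
move=> _ _ [F mF ->] [G mG ->]; exists (fun j => F j `&` G j).
  by move=> j; exact: measurableI.
by apply/seteqP; split => [t [tF tG] j|t tFG]; [|split=> j; case: (tFG j)].
Qed.

Lemma measurable_tuple_boxes :
  (measurable : set (set (N.-tuple T))) = <<s tuple_boxes >>.
Proof.
apply/seteqP; split.
  apply: smallest_sub; first exact: smallest_sigma_algebra.
  move=> B; rewrite -bigcup_seq => -[i /= _ [A mA <-]].
  apply: sub_sigma_algebra.
  exists (fun j => if j == i then A else setT).
    by move=> j; case: ifP.
  apply/seteqP; split => [t [_ tA] j|t /(_ i)]; last by rewrite eqxx.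
  by case: eqP => // ->.
apply: smallest_sub; first exact: sigma_algebra_measurable.
move=> _ [F mF ->].
have -> : [set t : N.-tuple T | forall j, F j (tnth t j)] =
    \bigcap_(j in [set: 'I_N]) ((@tnth _ T ^~ j) @^-1` F j).
  by apply/seteqP; split => [t tF j _|t tF j]; [exact: tF|exact: (tF j)].
apply: fin_bigcap_measurable; first exact: finite_finset.
move=> j _; rewrite -[X in measurable X]setTI.
exact: measurable_tnth.
Qed.

End TupleBoxes.

Section Independence.
Context d (T : measurableType d) (R : realType) (P : probability T R).
Context d' (T' : measurableType d') (N : nat) (X : 'I_N -> {RV P >-> T'}).
Hypothesis indX : independent_RV X.
Variable i : 'I_N.

(* The i-th entry is frozen to a constant, which leaves the others untouched. *)
Definition mask (w : T) : N.-tuple T' :=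
  [tuple if j == i then point else X j w | j < N].

Lemma measurable_mask : measurable_fun setT mask.
Proof.
apply/measurable_fun_tnthP => j.
rewrite (_ : _ \o _ = fun w => if j == i then point else X j w); last first.
  by apply/funext => w; rewrite /= tnth_mktuple.
by case: (j == i).
Qed.

(** Both sides are finite measures in [B], so it is enough to take a box for [B], where [indX]
    computes both. *)
Lemma independent_mask (A : set T') (B : set (N.-tuple T')) :
  measurable A -> measurable B ->
  P (X i @^-1` A `&` mask @^-1` B) = (P (X i @^-1` A) * P (mask @^-1` B))%E.
Proof.
move=> mA; set a := P (X i @^-1` A).
have mXA : measurable (X i @^-1` A).
  by rewrite -[X in measurable X]setTI; exact: measurable_funP.
have afin : a \is a fin_num by exact: fin_num_measure.
have a0 : 0 <= fine a by rewrite fine_ge0// measure_ge0.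
pose pushA := [the {measure set _ -> \bar R} of pushforward (mrestr P mXA) mask].
pose push := [the {measure set _ -> \bar R} of pushforward P mask].
pose m1 := pushA measurable_mask.
pose m2 := mscale (NngNum a0) (push measurable_mask).
move=> mB; suff : m1 B = m2 B.
  by rewrite /m1 /m2 /= /mscale /= /pushforward /mrestr fineK// setIC.
apply: (@measure_unique _ _ _ (@tuple_boxes _ T' N) (fun=> setT)) => //.
- exact: measurable_tuple_boxes.
- exact: setI_closed_tuple_boxes.
- by move=> _; exists (fun=> setT) => //; apply/seteqP; split.
- exact: bigcup_const.
- move=> _ [F mF ->].
  rewrite /m1 /m2 /= /mscale /= /pushforward /mrestr fineK//.
  have [Fi|Fi] := pselect (F i point); last first.
    rewrite (_ : mask @^-1` _ = set0) ?set0I ?measure0 ?mule0//.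
    by rewrite -subset0 => w /(_ i); rewrite tnth_mktuple eqxx.
  rewrite (_ : mask @^-1` _ = \bigcap_(j in [set` [set~ i]%SET]) X j @^-1` F j);
    last first.
    apply/seteqP; split => [w wF j|w wF j]; rewrite /= in wF *.
      rewrite !inE => /negbTE ji.
      by have := wF j; rewrite tnth_mktuple ji.
    rewrite tnth_mktuple; case: ifPn => [/eqP->//|ji].
    by apply: wF; rewrite /= !inE.
  rewrite indX//.
  have -> : (\bigcap_(j in [set` [set~ i]%SET]) X j @^-1` F j) `&` X i @^-1` A =
    \bigcap_(j in [set` [set: 'I_N]%SET])
      X j @^-1` (if j == i then A else F j).
    apply/seteqP; split => [w [wF wA] j _ /=|w wF].
      by case: ifPn => [/eqP->//|ji]; apply: wF; rewrite /= !inE.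
    split; last by have := wF i; rewrite /= eqxx inE; exact.
    by move=> j /=; rewrite !inE => /negbTE ji; have := wF j;
      rewrite /= ji inE; exact.
  rewrite indX; last by move=> j; case: ifP.
  rewrite (bigD1 i) ?inE//= eqxx; congr (_ * _)%E.
  apply: eq_big => j; rewrite ?inE// => ji.
  by rewrite (negbTE ji).
- move=> k; rewrite /m1 /= /pushforward /mrestr preimage_setT setTI.
  by rewrite -ge0_fin_numE ?measure_ge0.
Qed.

(** This replaces conditioning on the other vectors: the joint law of [X i] and the masked tuple is
    a product by [independent_mask], and Tonelli integrates over [X i] first. *)
Lemma integral_mask_le (g : T' * N.-tuple T' -> \bar R)
    (h : N.-tuple T' -> \bar R) :
  measurable_fun setT g -> (forall x, 0 <= g x)%E -> measurable_fun setT h ->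
  (forall t, \int[P]_w g (X i w, t) <= h t)%E ->
  (\int[P]_w g (X i w, mask w) <= \int[P]_w h (mask w))%E.
Proof.
move=> mg g0 mh gh.
pose W : {RV P >-> N.-tuple T'} :=
  HB.pack mask (isMeasurableFun.Build _ _ _ _ _ measurable_mask).
have mXW : measurable_fun setT (fun w => (X i w, mask w)).
  by apply: measurable_fun_pair => //; exact: measurable_mask.
pose XW : {RV P >-> (T' * N.-tuple T')%type} :=
  HB.pack (fun w => (X i w, mask w)) (isMeasurableFun.Build _ _ _ _ _ mXW).
have gE t : (\int[distribution P (X i)]_x g (x, t) = \int[P]_w g (X i w, t))%E.
  by rewrite ge0_integral_distribution//; exact: measurableT_comp.
have h0 t : (0 <= h t)%E by apply: le_trans (gh t); exact: integral_ge0.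
rewrite -[leRHS](ge0_integral_distribution W)// -[leLHS](ge0_integral_distribution XW)//.
rewrite (_ : (\int[_]_z g z)%E =
    (\int[(distribution P (X i) \x distribution P W)%E]_z g z)%E); last first.
  apply: eq_measure_integral => A mA _; apply/esym.
  apply: (@product_measure_unique _ _ _ _ _ _ _ (distribution P XW)) => //.
  move=> B C mB mC; rewrite /distribution /= /pushforward /=.
  by rewrite -independent_mask.
rewrite fubini_tonelli2//; apply: ge0_le_integral => //.
- by move=> t _; exact: integral_ge0.
- exact: measurable_fun_fubini_tonelli_G.
- by move=> t _; rewrite /fubini_G gE.
Qed.

End Independence.

(** * Tails of bilinear expressions *)

Section Euclid.
Context {R : realType}.
Implicit Types n N : nat.

Lemma dotp_ge0 n (x : 'rV[R]_n) : 0 <= dotp x x.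
Proof. by apply: sumr_ge0 => j _; rewrite -expr2 sqr_ge0. Qed.

Lemma dotpC n (x y : 'rV[R]_n) : dotp x y = dotp y x.
Proof. by apply: eq_bigr => j _; rewrite mulrC. Qed.

Lemma dotp0 n (x : 'rV[R]_n) : dotp x 0 = 0.
Proof. by rewrite /dotp big1// => j _; rewrite mxE mulr0. Qed.

Lemma dotpZr n a (x y : 'rV[R]_n) : dotp x (a *: y) = a * dotp x y.
Proof. by rewrite /dotp mulr_sumr; apply: eq_bigr => j _; rewrite mxE mulrCA. Qed.

Lemma dotpDr n (x y z : 'rV[R]_n) : dotp x (y + z) = dotp x y + dotp x z.
Proof.
by rewrite /dotp -big_split; apply: eq_bigr => j _; rewrite mxE mulrDr.
Qed.

Lemma dotp_sumr n (I : Type) (s : seq I) (p : pred I) (x : 'rV[R]_n) F :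
  dotp x (\sum_(i <- s | p i) F i) = \sum_(i <- s | p i) dotp x (F i).
Proof.
elim/big_rec2 : _ => [|i y1 y2 _ <-]; first exact: dotp0.
by rewrite dotpDr.
Qed.

Lemma enorm_ge0 n (x : 'rV[R]_n) : 0 <= enorm x.
Proof. exact: sqrtr_ge0. Qed.

Lemma sqr_enorm n (x : 'rV[R]_n) : enorm x ^+ 2 = dotp x x.
Proof. by rewrite sqr_sqrtr// dotp_ge0. Qed.

Lemma enorm_eq0 n (x : 'rV[R]_n) : (enorm x == 0) = (x == 0).
Proof.
apply/eqP/eqP => [|->]; last by rewrite /enorm dotp0 sqrtr0.
move=> x0; have : dotp x x = 0 by rewrite -sqr_enorm x0 expr0n.
move/eqP; rewrite psumr_eq0; last by move=> j _; rewrite -expr2 sqr_ge0.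
move/allP => h; apply/rowP => j; rewrite mxE; apply/eqP.
by have := h j (mem_index_enum _); rewrite mulf_eq0 orbb.
Qed.

Lemma norm_entry_le1 n (z : 'rV[R]_n) j : enorm z <= 1 -> `|z 0 j| <= 1.
Proof.
move=> z1; rewrite -(@expr_le1 _ 2)// real_normK ?num_real//.
apply: (@le_trans _ _ (enorm z ^+ 2)); last by rewrite expr_le1// enorm_ge0.
rewrite sqr_enorm /dotp (bigD1 j)//= -expr2 lerDl sumr_ge0// => k _.
by rewrite -expr2 sqr_ge0.
Qed.

Definition lincomb n N (x : 'I_N -> 'rV[R]_n) (u : 'rV[R]_N) : 'rV[R]_n :=
  \sum_(i < N) u 0 i *: x i.

(** The zero vector is kept, so that [dotp_normalize] and the tail estimates do not have to exclude
    [X v = 0]. *)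
Definition normalize n (y : 'rV[R]_n) : 'rV[R]_n := (enorm y)^-1 *: y.

Lemma normalize0 n : normalize (0 : 'rV[R]_n) = 0.
Proof. exact: scaler0. Qed.

Lemma enorm_normalize n (y : 'rV[R]_n) : y != 0 -> enorm (normalize y) = 1.
Proof.
rewrite -enorm_eq0 => y0.
rewrite {1}/enorm /normalize dotpZr dotpC dotpZr -sqr_enorm mulrA -expr2 -exprMn.
by rewrite mulVf// expr1n sqrtr1.
Qed.

Lemma dotp_lincomb n N (x : 'I_N -> 'rV[R]_n) u y :
  dotp (lincomb x u) y = \sum_(i < N) u 0 i * dotp (x i) y.
Proof.
by rewrite dotpC dotp_sumr; apply: eq_bigr => i _; rewrite dotpZr dotpC.
Qed.

Lemma dotp_normalize n (x y : 'rV[R]_n) :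
  dotp x y = enorm y * dotp x (normalize y).
Proof.
have [->|y0] := eqVneq y 0; first by rewrite normalize0 !dotp0 mulr0.
by rewrite dotpZr mulrA mulfV ?mul1r// enorm_eq0.
Qed.

End Euclid.

Section RowMeasurability.
Context d (T : measurableType d) {R : realType}.

Definition measurable_row n (f : T -> 'rV[R]_n) : Prop :=
  forall k, measurable_fun setT (fun w => f w 0 k).

Lemma measurable_set_lt (f g : T -> R) :
  measurable_fun setT f -> measurable_fun setT g ->
  measurable [set w | f w < g w].
Proof.
move=> mf mg; rewrite -[X in measurable X]setTI.
exact: (measurable_fun_ltr mf mg measurableT (Y := [set true])).
Qed.

Lemma measurable_set_le (f g : T -> R) :
  measurable_fun setT f -> measurable_fun setT g ->
  measurable [set w | f w <= g w].
Proof.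
move=> mf mg; rewrite -[X in measurable X]setTI.
exact: (measurable_fun_ler mf mg measurableT (Y := [set true])).
Qed.

Lemma measurable_dotp n (f g : T -> 'rV[R]_n) :
  measurable_row f -> measurable_row g ->
  measurable_fun setT (fun w => dotp (f w) (g w)).
Proof. by move=> mf mg; apply: measurable_sum => k; apply: measurable_funM. Qed.

Lemma measurable_enorm n (f : T -> 'rV[R]_n) :
  measurable_row f -> measurable_fun setT (fun w => enorm (f w)).
Proof.
move=> mf; apply: (@measurableT_comp _ _ _ _ _ _ (@Num.sqrt R)).
  apply: continuous_measurable_fun; exact: sqrt_continuous.
exact: measurable_dotp.
Qed.

Lemma measurable_normalize n (f : T -> 'rV[R]_n) :
  measurable_row f -> measurable_row (fun w => normalize (f w)).
Proof.
(* Measurability of the inverse is that of the power [-1]; the two agree at [0] as well. *)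
move=> mf k; rewrite (_ : (fun w => _) =
  (fun w => (enorm (f w)) `^ (- 1) * f w 0 k)); last first.
  by apply/funext => w; rewrite mxE powR_inv1 ?enorm_ge0.
apply: measurable_funM => //.
apply: (measurableT_comp (measurable_powR _)).
exact: measurable_enorm.
Qed.

Lemma measurable_lincomb n N (x : T -> 'I_N -> 'rV[R]_n) u :
  (forall i, measurable_row (x ^~ i)) ->
  measurable_row (fun w => lincomb (x w) u).
Proof.
move=> mx k; rewrite (_ : (fun w => _) =
  (fun w => \sum_(i < N) u 0 i * x w i 0 k)); last first.
  by apply/funext => w; rewrite summxE; apply: eq_bigr => i _; rewrite mxE.
by apply: measurable_sum => i; apply: measurable_funM => //; exact: mx.
Qed.

Lemma measurable_tuple_row n (f : T -> n.-tuple R) :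
  measurable_fun setT f -> measurable_row (fun w => tuple_row (f w)).
Proof.
move=> mf k; rewrite (_ : (fun w => _) = (@tnth _ R ^~ k) \o f); last first.
  by apply/funext => w; rewrite mxE.
by apply: measurableT_comp => //; exact: measurable_tnth.
Qed.

Lemma measurable_dotp_tuple_row n (f : T -> n.-tuple R) y :
  measurable_fun setT f -> measurable_fun setT (fun w => dotp (tuple_row (f w)) y).
Proof.
move=> mf; apply: measurable_dotp; first exact: measurable_tuple_row.
by move=> k; exact: measurable_cst.
Qed.

End RowMeasurability.

(** * Exponential moments and tails of [<X u, X v>] for disjoint supports *)

Section Tail.
Context d (T : measurableType d) (R : realType) (P : probability T R).
Context (n N : nat) (X : 'I_N -> {RV P >-> n.-tuple R}).
Variables (r s : R).
Hypothesis indX : independent_RV X.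
Hypotheses (r1 : 1 <= r) (r2 : r <= 2) (s0 : 0 < s).
Hypothesis psiX : forall i y, enorm y = 1 ->
  (\int[P]_w (expR ((`|dotp (tuple_row (X i w)) y| / s) `^ r))%:E <= 2%:E)%E.
Hypothesis centX : forall i y,
  (\int[P]_w (dotp (tuple_row (X i w)) y)%:E = 0)%E.

Notation rows t := (fun j => tuple_row (tnth t j)).
Notation Xrow w := (fun j => tuple_row (X j w)).

Lemma mgf_normalize_le i y (M mu : R) : 1 <= M -> `|mu| <= M `^ (r - 1) ->
  (\int[P]_w (expR (mu / s * dotp (tuple_row (X i w)) (normalize y)))%:E
     <= (expR (128 * mu ^+ 2 * M `^ (2 - r)))%:E)%E.
Proof.
move=> M1 hmu; have [->|y0] := eqVneq y 0.
  under eq_integral do rewrite normalize0 dotp0 mulr0 expR0.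
  rewrite integral_cst//= probability_setT mule1 lee_fin.
  rewrite -expR0 ler_expR; apply: mulr_ge0; last exact: powR_ge0.
  by apply: mulr_ge0 => //; exact: sqr_ge0.
under eq_integral do rewrite -mulrA [s^-1 * _]mulrC.
apply: (@mgf_psi_le _ _ _ P (fun w => dotp (tuple_row (X i w)) (normalize y) / s)).
- by apply: measurable_funM => //; exact: measurable_dotp_tuple_row.
- exact: r1.
- exact: r2.
- under eq_integral do rewrite normrM [`|s^-1|]gtr0_norm ?invr_gt0//.
  exact/psiX/enorm_normalize.
- exact: M1.
- exact: hmu.
- under eq_integral do rewrite mulrC EFinM.
  have m := measurable_dotp_tuple_row (normalize y) (measurable_funPT (X i)).
  rewrite integralZl//; first by rewrite centX mule0.
  rewrite (_ : (fun w => _) = (fun w => s%:E *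
     (dotp (tuple_row (X i w)) (normalize y) / s)%:E)%E); last first.
    by apply/funext => w; rewrite -EFinM mulrC divfK// gt_eqF.
  apply: integrableZl => //.
  apply: (@integrable_of_psi _ _ _ P _ r) => //.
  + by apply: measurable_funM.
  + under eq_integral do rewrite normrM [`|s^-1|]gtr0_norm ?invr_gt0//.
    exact/psiX/enorm_normalize.
Qed.

(** Induction on [F], integrating out one [X i] at a time. Since [v] vanishes on [F], the direction
    of [X v] does not involve [X i]; since [F] has no duplicates, neither does the rest of the sum.
    Both are thus functions of the masked tuple. *)
Lemma mgf_lincomb_normalize_le (F : seq 'I_N) (u v : 'rV[R]_N) (M la : R) :
  uniq F -> {in F, forall j, v 0 j = 0} -> 1 <= M ->
  {in F, forall j, `|la * u 0 j| <= M `^ (r - 1)} ->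
  (\int[P]_w (expR (\sum_(j <- F) la * u 0 j / s
      * dotp (tuple_row (X j w)) (normalize (lincomb (Xrow w) v))))%:E
     <= (expR (128 * la ^+ 2 * M `^ (2 - r) * \sum_(j <- F) u 0 j ^+ 2))%:E)%E.
Proof.
move=> + + M1; elim: F => [_ _ _|i F IH /=/andP[iF uF] vF uM].
  under eq_integral do rewrite big_nil expR0.
  by rewrite integral_cst//= probability_setT big_nil mulr0 expR0 mule1.
pose e (t : N.-tuple (n.-tuple R)) := normalize (lincomb (rows t) v).
have vi : v 0 i = 0 by apply: vF; rewrite mem_head.
have e_mask w : e (mask X i w) = normalize (lincomb (Xrow w) v).
  congr normalize; apply: eq_bigr => j _; rewrite tnth_mktuple.
  by case: eqP => // ->; rewrite vi !scale0r.
pose tl (t : N.-tuple (n.-tuple R)) :=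
  \sum_(j <- F) la * u 0 j / s * dotp (tuple_row (tnth t j)) (e t).
have tl_mask w : tl (mask X i w) = \sum_(j <- F) la * u 0 j / s
    * dotp (tuple_row (X j w)) (normalize (lincomb (Xrow w) v)).
  rewrite /tl e_mask big_seq [RHS]big_seq; apply: eq_bigr => j jF.
  rewrite tnth_mktuple; case: eqP => // ji.
  by move: iF; rewrite -ji jF.
have me d'' (T'' : measurableType d'') (f : T'' -> N.-tuple (n.-tuple R)) :
    measurable_fun setT f -> measurable_row (fun w => e (f w)).
  move=> mf; apply: measurable_normalize; apply: measurable_lincomb => j.
  apply: measurable_tuple_row.
  by apply: (@measurableT_comp _ _ _ _ _ _ (@tnth _ _ ^~ j)) => //;
    exact: measurable_tnth.
have mtl : measurable_fun setT tl.
  apply: measurable_sum => j; apply: measurable_funM => //.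
  apply: measurable_dotp; last by apply: me.
  by apply: measurable_tuple_row; exact: measurable_tnth.
pose g (z : n.-tuple R * N.-tuple (n.-tuple R)) : \bar R :=
  (expR (la * u 0 i / s * dotp (tuple_row z.1) (e z.2)) * expR (tl z.2))%:E.
have mg : measurable_fun setT g.
  apply/measurable_EFinP; apply: measurable_funM.
    apply: measurableT_comp => //; apply: measurable_funM => //.
    by apply: measurable_dotp; [exact: measurable_tuple_row|exact: me].
  by apply: measurableT_comp => //; exact: measurableT_comp.
have g0 z : (0 <= g z)%E by rewrite lee_fin mulr_ge0 ?expR_ge0.
have mtlm : measurable_fun setT (fun w => expR (tl (mask X i w))).
  by apply: measurableT_comp => //; apply: measurableT_comp => //;
    exact: measurable_mask.
rewrite (_ : (\int[P]_w _)%E = \int[P]_w g (X i w, mask X i w))%E; last first.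
  apply: eq_integral => w _; rewrite /g /= tl_mask e_mask.
  by rewrite big_cons expRD.
set c := expR (128 * (la * u 0 i) ^+ 2 * M `^ (2 - r)).
apply: (@le_trans _ _ (\int[P]_w (c * expR (tl (mask X i w)))%:E)%E).
  apply: (@integral_mask_le _ _ _ _ _ _ _ _ indX i g
      (fun t => (c * expR (tl t))%:E)) => //.
    apply/measurable_EFinP; apply: measurable_funM => //.
    exact: measurableT_comp.
  move=> t; rewrite /g /=; under eq_integral do rewrite mulrC EFinM.
  rewrite ge0_integralZl ?lee_fin ?expR_ge0//; last first.
    apply/measurable_EFinP; apply: measurableT_comp => //.
    by apply: measurable_funM => //; exact: measurable_dotp_tuple_row.
  rewrite [c * _]mulrC EFinM lee_wpmul2l ?lee_fin ?expR_ge0//.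
  by apply: mgf_normalize_le => //; apply: uM; rewrite mem_head.
under eq_integral do rewrite EFinM.
rewrite ge0_integralZl ?lee_fin ?expR_ge0//; last exact/measurable_EFinP.
under eq_integral do rewrite tl_mask.
rewrite big_cons mulrDr expRD EFinM.
have -> : 128 * la ^+ 2 * M `^ (2 - r) * u 0 i ^+ 2 =
  128 * (la * u 0 i) ^+ 2 * M `^ (2 - r) by ring.
rewrite lee_wpmul2l ?lee_fin ?expR_ge0//; apply: IH => // j jF.
  by apply: vF; rewrite in_cons jF orbT.
by apply: uM; rewrite in_cons jF orbT.
Qed.

Lemma tail_one_sided_le (u v : 'rV[R]_N) (M al : R) :
  1 <= M -> 0 < al -> enorm u <= 1 -> (forall j, `|u 0 j| <= al) ->
  (forall j, u 0 j * v 0 j = 0) ->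
  (P [set w | M / al * s * enorm (lincomb (Xrow w) v)
        < dotp (lincomb (Xrow w) u) (lincomb (Xrow w) v)]%R
    <= (expR (- (M `^ r / (512 * al ^+ 2))))%:E)%E.
Proof.
move=> M1 al0 u1 ual uv; have M0 : 0 < M by lra.
(* Outside [F] the entries of [u] vanish, so the sum over [F] is the whole form. *)
pose F := [seq j <- enum 'I_N | v 0 j == 0].
pose S w := \sum_(j <- F) u 0 j / s
  * dotp (tuple_row (X j w)) (normalize (lincomb (Xrow w) v)).
have dotpE w : dotp (lincomb (Xrow w) u) (lincomb (Xrow w) v) =
    s * enorm (lincomb (Xrow w) v) * S w.
  rewrite dotp_normalize dotp_lincomb mulrAC mulrC; congr (_ * _).
  rewrite /S big_filter big_enum_cond/= mulr_sumr [LHS]big_mkcond [RHS]big_mkcond/=.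
  apply: eq_bigr => j _; case: ifPn => v0.
    by rewrite mulrA mulrCA mulfV ?mulr1// gt_eqF.
  by have /eqP := uv j; rewrite mulf_eq0 (negbTE v0) orbF => /eqP ->; rewrite mul0r.
have mS : measurable_fun setT S.
  apply: measurable_sum => j; apply: measurable_funM => //.
  apply: measurable_dotp; first exact: measurable_tuple_row.
  by apply: measurable_normalize; apply: measurable_lincomb => k;
    exact: measurable_tuple_row.
pose Sm : {RV P >-> R} := HB.pack S (isMeasurableFun.Build _ _ _ _ _ mS).
(* The minimizer of [128 la^2 M^(2-r) - la M / al], with minimum [- M^r / (512 al^2)]. Since
   [la al <= M^(r-1)], the moment bound applies to every coefficient. *)
pose la := M `^ (r - 1) / (256 * al).
have al256 : 0 < 256 * al by lra.
have la0 : 0 < la by exact: divr_gt0 (powR_gt0 _ M0) al256.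
apply: (@le_trans _ _ (P [set w | Sm w >= M / al]%R)).
  apply: le_measure; rewrite ?inE.
  - apply: measurable_set_lt.
      by apply: measurable_funM => //; apply: measurable_enorm;
        apply: measurable_lincomb => k; exact: measurable_tuple_row.
    by apply: measurable_dotp; apply: measurable_lincomb => k;
      exact: measurable_tuple_row.
  - by apply: measurable_set_le.
  - move=> w /=; rewrite dotpE -[_ * s * _]mulrA [_ * (s * _)]mulrC => h.
    rewrite leNgt; apply/negP => /ltW hS.
    by move: h; rewrite ltNge ler_wpM2l// mulr_ge0 ?enorm_ge0// ltW.
apply: (le_trans (chernoff Sm _ la0)).
have mgf : ('M_P Sm la <= (expR (128 * la ^+ 2 * M `^ (2 - r)))%:E)%E.
  rewrite /mmt_gen_fun unlock.
  apply: (@le_trans _ _ (expR (128 * la ^+ 2 * M `^ (2 - r)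
                              * \sum_(j <- F) u 0 j ^+ 2))%:E).
    apply: le_trans (@mgf_lincomb_normalize_le F u v M la _ _ M1 _).
    - rewrite le_eqVlt; apply/orP; left; apply/eqP.
      apply: eq_integral => w _ /=; rewrite /S mulr_suml.
      by congr (expR _)%:E; apply: eq_bigr => j _; rewrite mulrC !mulrA.
    - by rewrite filter_uniq// enum_uniq.
    - by move=> j; rewrite mem_filter => /andP[/eqP].
    - move=> j _; rewrite normrM gtr0_norm// /la.
      have p0 := powR_ge0 M (r - 1).
      rewrite -mulrA; apply: (ler_piMr p0); rewrite (ler_pdivrMl _ _ al256) mulr1.
      by have := ual j; nra.
  rewrite lee_fin ler_expR ler_piMr//.
    by rewrite mulr_ge0 ?powR_ge0// mulr_ge0 ?sqr_ge0.
  apply: (@le_trans _ _ (enorm u ^+ 2)); last first.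
    by rewrite expr_le1// ?enorm_ge0.
  rewrite sqr_enorm big_filter big_enum_cond/= big_mkcond/=; apply: ler_sum => j _.
  by rewrite -expr2; case: ifP => // _; rewrite sqr_ge0.
apply: (@le_trans _ _ ((expR (128 * la ^+ 2 * M `^ (2 - r)))%:E
                       * (expR (- (la * (M / al))))%:E)%E).
  by rewrite lee_wpmul2r ?lee_fin ?expR_ge0.
rewrite -EFinM -expRD lee_fin ler_expR le_eqVlt; apply/orP; left; apply/eqP.
have MrE : M `^ r = M * M `^ (r - 1) by rewrite mulr_powRB1 ?(lt_le_trans ltr01 r1)// ltW.
have M2 : M `^ (2 - r) * M `^ (r - 1) = M.
  rewrite -powRD; last by rewrite (gt_eqF M0) implybT.
  by rewrite addrA subrK (_ : 2 - 1 = 1) ?powRr1 ?ltW//; lra.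
have -> : 128 * la ^+ 2 * M `^ (2 - r) =
    128 * (M `^ (2 - r) * M `^ (r - 1)) * M `^ (r - 1) / (256 * al) ^+ 2.
  by rewrite /la; field; rewrite gt_eqF.
rewrite M2 MrE /la; field; rewrite gt_eqF//.
Qed.

Lemma tail_bilinear_le (u v : 'rV[R]_N) (M al : R) :
  1 <= M -> 0 < al -> enorm u <= 1 -> (forall j, `|u 0 j| <= al) ->
  (forall j, u 0 j * v 0 j = 0) ->
  (P [set w | M / al * s * enorm (lincomb (Xrow w) v)
        < `|dotp (lincomb (Xrow w) u) (lincomb (Xrow w) v)|]%R
    <= (2 * expR (- (M `^ r / (512 * al ^+ 2))))%:E)%E.
Proof.
move=> M1 al0 u1 ual uv.
have lincombN w : lincomb (Xrow w) (- u) = - lincomb (Xrow w) u.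
  by rewrite /lincomb -sumrN; apply: eq_bigr => j _; rewrite mxE scaleNr.
have dotpN n' (a b : 'rV[R]_n') : dotp (- a) b = - dotp a b.
  by rewrite -scaleN1r dotpC dotpZr dotpC mulN1r.
have uN1 : enorm (- u) <= 1 by rewrite /enorm dotpN dotpC dotpN opprK.
have uNal j : `|(- u) 0 j| <= al by rewrite mxE normrN.
have uvN j : (- u) 0 j * v 0 j = 0 by rewrite mxE mulNr uv oppr0.
have t1 := tail_one_sided_le M1 al0 u1 ual uv.
have t2 := tail_one_sided_le M1 al0 uN1 uNal uvN.
have m0 u' : measurable [set w | M / al * s * enorm (lincomb (Xrow w) v)
        < dotp (lincomb (Xrow w) u') (lincomb (Xrow w) v)].
  apply: measurable_set_lt.
    by apply: measurable_funM => //; apply: measurable_enorm;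
      apply: measurable_lincomb => k; exact: measurable_tuple_row.
  by apply: measurable_dotp; apply: measurable_lincomb => k;
    exact: measurable_tuple_row.
rewrite mulr_natl mulr2n EFinD; apply: le_trans (leeD t1 t2).
apply: le_trans (measureU2 _ (m0 u) (m0 (- u))).
rewrite le_eqVlt; apply/orP; left; apply/eqP; congr (P _).
apply/seteqP; split => w /=; rewrite lincombN dotpN.
  by rewrite ltr_normr => /orP[]; [left|right].
by case=> h; rewrite ltr_normr h ?orbT.
Qed.

End Tail.

(** * Nets *)

Section Grid.
Context {R : realType}.
Variables (N s : nat).
Hypotheses (N0 : (0 < N)%N) (s0 : (0 < s)%N).

(** With mesh [1 / (2 sqrt s)], rounding down a vector supported on [s] indices costs at most [1/2]
    in norm. A grid point of the unit ball has [\sum_i w i ^ 2 <= 4 * s], so values up to [4 * s]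
    suffice. *)
Definition grid_index := {ffun 'I_N -> 'I_(4 * s).+1}.

Definition grid (w : grid_index) : 'rV[R]_N :=
  \row_i ((w i)%:R / (2 * Num.sqrt s%:R)).

Let s0R : 0 < s%:R :> R. Proof. by rewrite ltr0n. Qed.
Let N0R : 0 < N%:R :> R. Proof. by rewrite ltr0n. Qed.
Let sq0 : 0 < Num.sqrt s%:R :> R. Proof. by rewrite sqrtr_gt0. Qed.
Let sq2 : Num.sqrt s%:R ^+ 2 = s%:R :> R. Proof. by rewrite sqr_sqrtr// ltW. Qed.

(* Generating function: with [a = 1 + N / s], each [w] in the set contributes
   at least [1] to [a ^+ (4 * s) * \sum_w \prod_i a ^- (w i)]. *)
Lemma card_small_sum_le :
  #|[set w : grid_index | (\sum_i w i <= 4 * s)%N]%SET|%:R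
    <= (1 + N%:R / s%:R) ^+ (4 * s) * expR s%:R :> R.
Proof.
set a : R := 1 + N%:R / s%:R.
have a1 : 1 < a by rewrite ltrDl divr_gt0.
have a0 : 0 < a by lra.
have q1 : a^-1 < 1 by rewrite invf_lt1.
have q0 : 0 < a^-1 by rewrite invr_gt0.
(* The full series is [(1 - a^-1)^-1 = 1 + s / N]; the choice of [a] makes its [N]-th power at most
   [expR s]. *)
have geo : \sum_(j < (4 * s).+1) a^-1 ^+ j <= expR (s%:R / N%:R).
  apply: le_trans (expR_ge1Dx _).
  have -> : 1 + s%:R / N%:R = (1 - a^-1)^-1.
    rewrite /a; field; rewrite addrAC subrr add0r.
    by rewrite !gt_eqF// addr_gt0.
  rewrite -[leRHS]mul1r ler_pdivlMr ?subr_gt0// mulrC.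
  have := subrX1 a^-1 (4 * s).+1.
  rewrite -[_ - 1]opprB -[a^-1 - 1]opprB mulNr => /oppr_inj <-.
  by rewrite lerBlDr lerDl exprn_ge0 ?ltW.
apply: (@le_trans _ _ (\sum_(w : grid_index) a ^+ (4 * s) * \prod_i a^-1 ^+ w i)).
  rewrite -sum1_card natr_sum [leLHS]big_mkcond/=; apply: ler_sum => w _.
  case: ifPn => [|_]; last first.
    apply: mulr_ge0; first by rewrite exprn_ge0// ltW.
    by apply: prodr_ge0 => i _; rewrite exprn_ge0// ltW.
  rewrite inE => ws; rewrite -expr_sum exprVn ler_pdivlMr ?exprn_gt0// mul1r.
  by rewrite ler_weXn2l// ltW.
rewrite -mulr_sumr ler_wpM2l ?exprn_ge0 ?(ltW a0)//.
rewrite -(bigA_distr_bigA (fun (_ : 'I_N) (j : 'I_(4 * s).+1) => a^-1 ^+ j)).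
rewrite prodr_const card_ord.
apply: (@le_trans _ _ (expR (s%:R / N%:R) ^+ N)).
  by rewrite lerXn2r ?nnegrE ?expR_ge0// sumr_ge0// => j _; rewrite exprn_ge0// ltW.
by rewrite -expRM_natl mulrC divfK// gt_eqF.
Qed.

(** [w <= w ^ 2] for natural numbers. Together with [card_small_sum_le] this counts the net points
    of all supports at once, without a separate choice of an [s]-subset. *)
Lemma grid_sum_le (w : grid_index) :
  enorm (grid w) <= 1 -> (\sum_i w i <= 4 * s)%N.
Proof.
move=> w1; apply: (@leq_trans (\sum_i w i ^ 2)).
  by apply: leq_sum => i _; rewrite -mulnn; case: (nat_of_ord _) => // k; rewrite leq_pmulr.
have : enorm (grid w) ^+ 2 <= 1 by rewrite expr_le1// enorm_ge0.
rewrite sqr_enorm /dotp.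
rewrite (eq_bigr (fun i => (w i ^ 2)%:R / (4 * s)%:R)); last first.
  by move=> i _; rewrite !mxE natrX natrM mulrACA -invfM mulrACA -!expr2 sq2;
    congr (_ / (_ * _)); lra.
rewrite -mulr_suml ler_pdivrMr ?ltr0n ?muln_gt0// mul1r -natr_sum ler_nat.
by [].
Qed.

Lemma exists_grid_below (u : 'rV[R]_N) : (forall j, 0 <= u 0 j) ->
  enorm u <= 1 -> exists w : grid_index, forall j,
    [/\ 0 <= grid w 0 j, grid w 0 j <= u 0 j
      & u 0 j - grid w 0 j <= (2 * Num.sqrt s%:R)^-1].
Proof.
move=> u0 u1; pose t j := Num.truncn (u 0 j * (2 * Num.sqrt s%:R)).
have c0 : 0 < 2 * Num.sqrt s%:R :> R by rewrite mulr_gt0.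
have tP j : (t j)%:R <= u 0 j * (2 * Num.sqrt s%:R) < (t j).+1%:R.
  by apply: truncn_itv; rewrite mulr_ge0 ?u0// ltW.
have uj1 j : u 0 j ^+ 2 <= 1.
  by rewrite -(real_normK (num_real (u 0 j))) expr_le1// norm_entry_le1.
have tlt j : (t j < (4 * s).+1)%N.
  rewrite ltnS -(ler_nat R) natrM.
  have /andP[h _] := tP j.
  apply: (@le_trans _ _ ((t j)%:R ^+ 2)).
    by rewrite -natrX ler_nat -mulnn; case: (t j) => // k; rewrite leq_pmulr.
  apply: (@le_trans _ _ ((u 0 j * (2 * Num.sqrt s%:R)) ^+ 2)).
    by rewrite lerXn2r ?nnegrE ?ler0n// (le_trans _ h).
  rewrite !exprMn sq2; have := uj1 j; have := s0R; nra.
exists [ffun j => Ordinal (tlt j)] => j.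
have /andP[h1 h2] := tP j.
rewrite mxE ffunE /=; split.
- by rewrite divr_ge0// ltW.
- by rewrite ler_pdivrMr.
- rewrite -(ler_pM2r c0) mulrBl divfK ?gt_eqF// mulVf ?gt_eqF//.
  by move: h2; rewrite -natr1; lra.
Qed.

End Grid.
Arguments grid R {N s} w.

Section Gram.
Context {R : realType} (n N : nat) (x : 'I_N -> 'rV[R]_n).
Implicit Types u v : 'rV[R]_N.

Definition gram u v : R := dotp (lincomb x u) (lincomb x v).

Lemma gramC u v : gram u v = gram v u. Proof. exact: dotpC. Qed.

Lemma lincombD u v : lincomb x (u + v) = lincomb x u + lincomb x v.
Proof.
by rewrite /lincomb -big_split; apply: eq_bigr => j _; rewrite mxE scalerDl.
Qed.

Lemma lincombZ a u : lincomb x (a *: u) = a *: lincomb x u.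
Proof.
by rewrite /lincomb scaler_sumr; apply: eq_bigr => j _; rewrite mxE scalerA.
Qed.

Lemma gramDr u v w : gram u (v + w) = gram u v + gram u w.
Proof. by rewrite /gram lincombD dotpDr. Qed.

Lemma gramDl u v w : gram (u + v) w = gram u w + gram v w.
Proof. by rewrite gramC gramDr !(gramC w). Qed.

Lemma gramZr a u v : gram u (a *: v) = a * gram u v.
Proof. by rewrite /gram lincombZ dotpZr. Qed.

Lemma gramZl a u v : gram (a *: u) v = a * gram u v.
Proof. by rewrite gramC gramZr gramC. Qed.

Lemma gramBr u v w : gram u (v - w) = gram u v - gram u w.
Proof. by rewrite gramDr -scaleN1r gramZr mulN1r. Qed.

Lemma gramBl u v w : gram (u - v) w = gram u w - gram v w.
Proof. by rewrite !(gramC _ w) gramBr. Qed.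

Lemma gramE u v :
  gram u v = \sum_i \sum_j u 0 i * v 0 j * dotp (x i) (x j).
Proof.
rewrite /gram dotp_lincomb; apply: eq_bigr => i _.
rewrite dotpC dotp_lincomb mulr_sumr; apply: eq_bigr => j _.
by rewrite mulrA dotpC.
Qed.

End Gram.

Lemma norm_dotp_le {R : realType} n (y z : 'rV[R]_n) A :
  enorm y <= A -> enorm z <= A -> `|dotp y z| <= A ^+ 2.
Proof.
move=> yA zA; have A0 : 0 <= A by apply: le_trans yA; exact: enorm_ge0.
have yA2 : dotp y y <= A ^+ 2 by rewrite -sqr_enorm lerXn2r ?nnegrE ?enorm_ge0.
have zA2 : dotp z z <= A ^+ 2 by rewrite -sqr_enorm lerXn2r ?nnegrE ?enorm_ge0.
have h : 2 * `|dotp y z| <= dotp y y + dotp z z.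
  apply: (@le_trans _ _ (2 * \sum_j `|y 0 j * z 0 j|)).
    by rewrite ler_pM2l// ler_norm_sum.
  rewrite mulr_sumr -big_split/=; apply: ler_sum => j _.
  rewrite normrM -!expr2 -(real_normK (num_real (y 0 j))).
  rewrite -(real_normK (num_real (z 0 j))).
  have := sqr_ge0 (`|y 0 j| - `|z 0 j|); nra.
lra.
Qed.

(* The supremum [S] of [`|f|] over [K] satisfies [S <= t + S / 2]. *)
Lemma bound_of_half_net {R : realType} (V : Type) (K : set V) (f : V -> R) (t B : R) :
  (forall u, K u -> `|f u| <= B) ->
  (forall u, K u -> exists2 u', K u' &
      exists2 b, `|b| <= t & f u = b + 2^-1 * f u') ->
  forall u, K u -> `|f u| <= 2 * t.
Proof.
move=> fB net u Ku; set S := [set `|f u| | u in K].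
have supS : has_sup S.
  split; first by exists `|f u|, u.
  by exists B => _ [v Kv <-]; exact: fB.
have le_sup v : K v -> `|f v| <= sup S.
  by move=> Kv; apply: sup_upper_bound => //; exists v.
suff : sup S <= 2 * t by move=> h; exact: le_trans (le_sup _ Ku) h.
have : sup S <= t + 2^-1 * sup S.
  apply: ge_sup; first by exists `|f u|, u.
  move=> _ [v Kv <-]; have [v' Kv' [b bt ->]] := net _ Kv.
  apply: le_trans (ler_normD _ _) _; rewrite lerD// normrM gtr0_norm ?invr_gt0//.
  by rewrite ler_pM2l ?invr_gt0// le_sup.
lra.
Qed.

(** * From the net to all disjointly supported pairs *)

Section Net.
Context {R : realType} (n N s : nat) (x : 'I_N -> 'rV[R]_n).
Hypotheses (s0 : (0 < s)%N).

(* The bound [al] on the entries is what keeps the tails of [gram] light;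
   nonnegativity lets the grid approximate from below. *)
Definition pos_box (S : {set 'I_N}) (al : R) : set 'rV[R]_N :=
  [set u : 'rV[R]_N | [/\ forall j, 0 <= u 0 j, forall j, u 0 j <= al,
               forall j, j \notin S -> u 0 j = 0 & enorm u <= 1]].

Let s0R : 0 < s%:R :> R. Proof. by rewrite ltr0n. Qed.
Let sq0 : 0 < Num.sqrt s%:R :> R. Proof. by rewrite sqrtr_gt0. Qed.

(** Rounding down a nonnegative vector only decreases entries, support and norm. The doubled error
    has at most [s] nonzero entries, each at most [1 / sqrt s], hence norm at most [1] and entries
    at most [al]. *)
Lemma pos_box_grid (S : {set 'I_N}) (al : R) (u : 'rV[R]_N) : (#|S| <= s)%N ->
  (Num.sqrt s%:R)^-1 <= al -> pos_box S al u ->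
  exists2 w : grid_index N s, pos_box S al (grid R w) &
    pos_box S al (2 *: (u - grid R w)).
Proof.
move=> Ss sal [u0 ual uS u1].
have [w wP] := exists_grid_below s0 u0 u1; exists w.
  split.
  - by move=> j; have [] := wP j.
  - by move=> j; have [_ h _] := wP j; apply: le_trans h (ual j).
  - by move=> j /uS uj; have [a b _] := wP j; apply/eqP; rewrite eq_le a -uj b.
  - apply: le_trans u1; rewrite ler_sqrt ?dotp_ge0//; apply: ler_sum => j _.
    by have [a b _] := wP j; rewrite ler_pM.
have d0 j : 0 <= (2 *: (u - grid R w)) 0 j.
  by have [a b _] := wP j; rewrite !mxE in a b *; lra.
have dle j : (2 *: (u - grid R w)) 0 j <= (Num.sqrt s%:R)^-1.
  have [_ _ c] := wP j.
  have -> : (Num.sqrt s%:R)^-1 = 2 * (2 * Num.sqrt s%:R)^-1 :> R.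
    by rewrite invfM mulrA mulfV ?mul1r.
  by move: c; rewrite !mxE => c; lra.
have dS j : j \notin S -> (2 *: (u - grid R w)) 0 j = 0.
  move=> /uS uj; have [a b _] := wP j.
  by rewrite !mxE in a b uj *; lra.
split => //; first by move=> j; apply: le_trans (dle j) sal.
rewrite -(@expr_le1 _ 2)// ?enorm_ge0// sqr_enorm.
apply: (@le_trans _ _ (\sum_(j in S) s%:R^-1)).
  rewrite /dotp [leRHS]big_mkcond/=; apply: ler_sum => j _.
  case: ifPn => [_|/dS ->]; last by rewrite mulr0.
  have -> : s%:R^-1 = (Num.sqrt s%:R)^-1 * (Num.sqrt s%:R)^-1 :> R.
    by rewrite -invfM -expr2 sqr_sqrtr// ltW.
  by rewrite ler_pM.
by rewrite sumr_const -[_ *+ _]mulr_natl ler_pdivrMr// mul1r ler_nat.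
Qed.

(** Disjointness is stated by coordinates, so that one finite family serves all pairs of supports
    [U], [V]. Only the first point obeys the bound [al]. *)
Definition good_pair (al : R) (p : grid_index N s * grid_index N s) : bool :=
  [&& enorm (grid R p.1) <= 1, enorm (grid R p.2) <= 1,
      [forall j, grid R p.1 0 j <= al]
    & [forall j, grid R p.1 0 j * grid R p.2 0 j == 0]].

Variables (al t A : R).
Hypothesis sal : (Num.sqrt s%:R)^-1 <= al.
Hypothesis s1 : (Num.sqrt s%:R)^-1 <= 1 :> R.
Hypothesis t0 : 0 <= t.
Hypothesis netP : forall p, good_pair al p ->
  `|gram x (grid R p.1) (grid R p.2)| <= t * enorm (lincomb x (grid R p.2)).
Hypothesis AP : forall v : 'rV[R]_N,
  (#|supp v| <= s)%N -> enorm v <= 1 -> enorm (lincomb x v) <= A.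

Lemma supp_pos_box (S : {set 'I_N}) b u : (#|S| <= s)%N -> pos_box S b u ->
  (#|supp u| <= s)%N.
Proof.
move=> Ss [_ _ uS _]; apply: leq_trans Ss; apply: subset_leq_card.
by apply/fintype.subsetP => j; rewrite inE; apply: contraR => /uS/eqP.
Qed.

(** [4 = 2 * 2]: the second argument is discretized with the first one on the grid, then the first
    one for arbitrary [v]. The bound [A ^+ 2] serves only to make the suprema finite. *)
Lemma gram_pos_box_le (U V : {set 'I_N}) u v : (#|U| <= s)%N -> (#|V| <= s)%N ->
  {in U, forall j, j \notin V} -> pos_box U al u -> pos_box V 1 v ->
  `|gram x u v| <= 4 * (t * A).
Proof.
move=> Us Vs UV uP vP.
have bdA b b' a c : pos_box U b a -> pos_box V b' c -> `|gram x a c| <= A ^+ 2.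
  move=> aP cP; apply: norm_dotp_le; apply: AP.
  - exact: supp_pos_box aP.
  - by case: aP.
  - exact: supp_pos_box cP.
  - by case: cP.
have net2 (w : grid_index N s) : pos_box U al (grid R w) -> `|gram x (grid R w) v| <= 2 * (t * A).
  move=> wP; apply: (@bound_of_half_net _ _ (pos_box V 1) _ _ (A ^+ 2)) => //.
    by move=> c cP; exact: bdA wP cP.
  move=> c cP; have [w' w'P dP] := pos_box_grid Vs s1 cP.
  exists (2 *: (c - grid R w')) => //.
  exists (gram x (grid R w) (grid R w')).
    apply: (@le_trans _ _ (t * enorm (lincomb x (grid R w')))).
      have := @netP (w, w'); apply; apply/and4P; split => /=.
      - by case: wP.
      - by case: w'P.
      - by apply/forallP; case: wP.
      - apply/forallP => j; have [jU|jU] := boolP (j \in U).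
          have jV : j \notin V by exact: UV.
          by case: w'P => _ _ /(_ _ jV) -> _; rewrite mulr0.
        by case: wP => _ _ /(_ _ jU) -> _; rewrite mul0r.
    by rewrite ler_wpM2l// AP//; [exact: supp_pos_box w'P|case: w'P].
  by rewrite gramZr mulrA mulVf// mul1r gramBr addrC subrK.
have -> : 4 * (t * A) = 2 * (2 * (t * A)) by lra.
apply: (@bound_of_half_net _ _ (pos_box U al) (gram x ^~ v) _ (A ^+ 2)) => //.
  by move=> c cP; exact: bdA cP vP.
move=> c cP; have [w wP dP] := pos_box_grid Us sal cP.
exists (2 *: (c - grid R w)) => //.
exists (gram x (grid R w) v); first exact: net2.
by rewrite gramZl mulrA mulVf// mul1r gramBl addrC subrK.
Qed.

Lemma pos_box_parts (S : {set 'I_N}) b (u : 'rV[R]_N) : (forall j, `|u 0 j| <= b) ->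
  (forall j, j \notin S -> u 0 j = 0) -> enorm u <= 1 ->
  exists up un, [/\ pos_box S b up, pos_box S b un & u = up - un].
Proof.
move=> ub uS u1.
exists (\row_j Num.max 0 (u 0 j)), (\row_j Num.max 0 (- u 0 j)); split.
- split.
  + by move=> j; rewrite mxE le_max lexx.
  + move=> j; have := ub j; have := normr_ge0 (u 0 j).
    by rewrite mxE ge_max ler_norml => a /andP[]; lra.
  + by move=> j /uS uj; rewrite mxE uj maxxx.
  + apply: le_trans u1; rewrite ler_sqrt ?dotp_ge0//; apply: ler_sum => j _.
    by rewrite mxE; case: (leP 0 (u 0 j)) => [_//|_]; rewrite mulr0 -expr2 sqr_ge0.
- split.
  + by move=> j; rewrite mxE le_max lexx.
  + move=> j; have := ub j; have := normr_ge0 (u 0 j).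
    by rewrite mxE ge_max ler_norml => a /andP[]; lra.
  + by move=> j /uS uj; rewrite mxE uj oppr0 maxxx.
  + apply: le_trans u1; rewrite ler_sqrt ?dotp_ge0//; apply: ler_sum => j _.
    by rewrite mxE; case: (leP 0 (- u 0 j)) => [_|_]; rewrite ?mulrNN// mulr0 -expr2 sqr_ge0.
- by apply/rowP => j; rewrite !mxE; case: (leP 0 (u 0 j)); case: (leP 0 (- u 0 j)); lra.
Qed.

(** Splitting [u] and [v] into positive and negative parts gives four terms, each at most
    [4 * (t * A)]. *)
Lemma gram_le_of_net (U V : {set 'I_N}) (u v : 'rV[R]_N) :
  (#|U| <= s)%N -> (#|V| <= s)%N -> {in U, forall j, j \notin V} ->
  (forall j, j \notin U -> u 0 j = 0) -> (forall j, j \notin V -> v 0 j = 0) ->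
  enorm u <= 1 -> enorm v <= 1 -> (forall j, `|u 0 j| <= al) ->
  `|gram x u v| <= 16 * (t * A).
Proof.
move=> Us Vs UV uU vV u1 v1 ual.
have v1' j : `|v 0 j| <= 1 by exact: norm_entry_le1.
have [up [un [upP unP ->]]] := pos_box_parts ual uU u1.
have [vp [vn [vpP vnP ->]]] := pos_box_parts v1' vV v1.
have b := gram_pos_box_le Us Vs UV.
rewrite gramBl !gramBr.
have := b _ _ upP vpP; have := b _ _ upP vnP.
have := b _ _ unP vpP; have := b _ _ unP vnP.
rewrite !ler_norml => /andP[? ?] /andP[? ?] /andP[? ?] /andP[? ?].
by apply/andP; split; lra.
Qed.

End Net.

Lemma measure_bigsetU_le d (T : measurableType d) (R : realType)
    (P : probability T R) (I : Type) (s : seq I) (p : pred I) (F : I -> set T) :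
  (forall i, measurable (F i)) ->
  measurable (\big[setU/set0]_(i <- s | p i) F i) /\
  (P (\big[setU/set0]_(i <- s | p i) F i) <= \sum_(i <- s | p i) P (F i))%E.
Proof.
move=> mF; elim/big_rec2 : _ => [|i B A _ [mA PA]]; first by rewrite measure0.
split; first exact: measurableU.
by apply: (le_trans (measureU2 _ (mF i) mA)); rewrite leeD2l.
Qed.


(** * Union bound over the net of one level *)

Section Level.
Context d (T : measurableType d) (R : realType) (P : probability T R).
Context (n N : nat) (X : 'I_N -> {RV P >-> n.-tuple R}).
Variables (r psi : R).
Hypothesis indX : independent_RV X.
Hypotheses (r1 : 1 <= r) (r2 : r <= 2) (psi0 : 0 < psi).
Hypothesis psiX : forall i y, enorm y = 1 ->
  (\int[P]_w (expR ((`|dotp (tuple_row (X i w)) y| / psi) `^ r))%:E <= 2%:E)%E.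
Hypothesis centX : forall i y,
  (\int[P]_w (dotp (tuple_row (X i w)) y)%:E = 0)%E.
Hypothesis N0 : (0 < N)%N.

Notation Xrow w := (fun j => tuple_row (X j w)).

Definition pair_bad s (al M : R) (p : grid_index N s * grid_index N s) : set T :=
  [set w | M / al * psi * enorm (lincomb (Xrow w) (grid R p.2))
             < `|gram (Xrow w) (grid R p.1) (grid R p.2)|].

Definition level_bad s (al M : R) : set T :=
  \big[setU/set0]_(p | good_pair al p) @pair_bad s al M p.

Lemma measurable_pair_bad s al M p : measurable (@pair_bad s al M p).
Proof.
apply: measurable_set_lt.
  by apply: measurable_funM => //; apply: measurable_enorm;
    apply: measurable_lincomb => k; exact: measurable_tuple_row.
apply: measurableT_comp => //.
by apply: measurable_dotp; apply: measurable_lincomb => k;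
  exact: measurable_tuple_row.
Qed.

Lemma measurable_level_bad s al M : measurable (level_bad s al M).
Proof. by apply: bigsetU_measurable => p _; exact: measurable_pair_bad. Qed.

Lemma not_level_bad s al M w (p : grid_index N s * grid_index N s) :
  ~ level_bad s al M w -> good_pair al p ->
  `|gram (Xrow w) (grid R p.1) (grid R p.2)|
     <= M / al * psi * enorm (lincomb (Xrow w) (grid R p.2)).
Proof.
move=> wbad pg; rewrite leNgt; apply/negP => h; apply: wbad.
by rewrite /level_bad (bigD1 p)//=; left.
Qed.

(** The entropy hypothesis is twice the exponent of [card_small_sum_le], as pairs of grid points are
    counted. With [2 <= expR D] for the two signs, the exponents add up to [512 D + D - 515 D]. *)
Lemma level_bad_le s (al M D : R) : (0 < s)%N -> 1 <= M -> 0 < al -> 1 <= D ->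
  8 * s%:R * ln (1 + N%:R / s%:R) + 2 * s%:R <= 512 * D ->
  515 * 512 * al ^+ 2 * D <= M `^ r ->
  (P (level_bad s al M) <= (expR (- (2 * D)))%:E)%E.
Proof.
move=> s0 M1 al0 D1 ent big.
have s0R : 0 < s%:R :> R by rewrite ltr0n.
set c := 2 * expR (- (M `^ r / (512 * al ^+ 2))).
have c0 : 0 <= c by rewrite mulr_ge0 ?expR_ge0.
apply: (le_trans (proj2 (measure_bigsetU_le P _ _ (measurable_pair_bad al M)))).
apply: (@le_trans _ _ (\sum_(p : grid_index N s * grid_index N s | good_pair al p)
                        c%:E)%E).
  apply: lee_sum => p /and4P[g1 g2 /forallP gal /forallP gg].
  apply: tail_bilinear_le => //.
  - by move=> j; rewrite ger0_norm ?gal// mxE divr_ge0// mulr_ge0// sqrtr_ge0.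
  - by move=> j; apply/eqP.
rewrite sumEFin lee_fin sumr_const -[c *+ _]mulr_natl.
set S := [set w : grid_index N s | (\sum_i w i <= 4 * s)%N]%SET.
have card : (#|[pred p : grid_index N s * grid_index N s | good_pair al p]|
              <= #|S| * #|S|)%N.
  rewrite -cardsX; apply: subset_leq_card; apply/fintype.subsetP => p.
  rewrite !inE => /and4P[g1 g2 _ _].
  by apply/andP; split; [exact: grid_sum_le g1|exact: grid_sum_le g2].
have hS : #|S|%:R <= expR (4 * s%:R * ln (1 + N%:R / s%:R) + s%:R) :> R.
  apply: (le_trans (card_small_sum_le N0 s0)).
  have a0 : 0 < 1 + N%:R / s%:R :> R by rewrite addr_gt0// divr_gt0// ltr0n.
  by rewrite expRD -natrM expRM_natl lnK.
apply: (@le_trans _ _ (expR (4 * s%:R * ln (1 + N%:R / s%:R) + s%:R) ^+ 2 * c)).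
  rewrite ler_wpM2r//; apply: (@le_trans _ _ (#|S| * #|S|)%:R).
    by rewrite ler_nat.
  by rewrite natrM expr2 ler_pM.
have al2 : 0 < 512 * al ^+ 2 by have := exprn_gt0 2 al0; lra.
have h2 : 2 <= expR D by apply: le_trans (expR_ge1Dx _); lra.
apply: (@le_trans _ _ (expR (512 * D) * (expR D * expR (- (515 * D))))).
  apply: ler_pM => //.
    by rewrite -expRM_natl ler_expR; lra.
  apply: ler_pM; [exact: ler0n|exact: expR_ge0|exact: h2|].
  rewrite ler_expR lerN2 (ler_pdivlMr _ _ al2).
  by apply: le_trans big; lra.
by rewrite -!expRD ler_expR; lra.
Qed.

End Level.

(** * Decoupling and levels *)

Section Decoupling.
Context {R : realType} (n N : nat) (x : 'I_N -> 'rV[R]_n).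
Implicit Types (z : 'rV[R]_N) (I S : {set 'I_N}).

Definition offdiag z : R :=
  enorm (lincomb x z) ^+ 2 - \sum_(i < N) z 0 i ^+ 2 * enorm (x i) ^+ 2.

Definition restr S z : 'rV[R]_N := \row_j (if j \in S then z 0 j else 0).

Lemma offdiagE z : offdiag z =
  \sum_i \sum_(j | j != i) z 0 i * z 0 j * dotp (x i) (x j).
Proof.
rewrite /offdiag sqr_enorm -/(gram x z z) gramE -sumrB; apply: eq_bigr => i _.
by rewrite (bigD1 i)//= sqr_enorm -expr2 addrAC subrr add0r.
Qed.

Definition toggle (i : 'I_N) I : {set 'I_N} :=
  [set k | (k \in I) (+) (k == i)]%SET.

Lemma toggleK i : involutive (toggle i).
Proof.
by move=> I; apply/setP => k; rewrite !inE -addbA addbb addbF.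
Qed.

Lemma sum_toggle i (F : {set 'I_N} -> R) :
  \sum_(I : {set 'I_N}) F I = \sum_(I : {set 'I_N}) F (toggle i I).
Proof. by rewrite (reindex_inj (inv_inj (toggleK i))). Qed.

(** Toggling [i] or [j] is a bijection of the index sets, so the four membership patterns of [i] and
    [j] are equally frequent: [A1], [A2] and [A3] are the three others, and all four sum to [1] on
    each set. *)
Lemma card_separating (i j : 'I_N) : j != i ->
  4 * \sum_(I : {set 'I_N}) ((i \in I)%:R * (j \notin I)%:R) = #|{set 'I_N}|%:R :> R.
Proof.
move=> ji; set b := fun k (I : {set 'I_N}) => (k \in I)%:R : R.
have bN k I : (k \notin I)%:R = 1 - b k I by rewrite /b; case: (k \in I) => /=; lra.
have btog k l I : b k (toggle l I) = if k == l then 1 - b k I else b k I.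
  by rewrite /b inE; case: (k == l); case: (k \in I) => /=; lra.
under eq_bigr do rewrite bN -/(b i _).
have ij : i != j by rewrite eq_sym.
set A := \sum_(I : {set 'I_N}) _.
have A1 : A = \sum_(I : {set 'I_N}) (1 - b i I) * (1 - b j I).
  rewrite /A (sum_toggle i); apply: eq_bigr => I _.
  by rewrite !btog eqxx (negbTE ji).
have A2 : A = \sum_(I : {set 'I_N}) b i I * b j I.
  rewrite /A (sum_toggle j); apply: eq_bigr => I _.
  by rewrite !btog eqxx (negbTE ij); ring.
have A3 : A = \sum_(I : {set 'I_N}) (1 - b i I) * b j I.
  rewrite A1 (sum_toggle j); apply: eq_bigr => I _.
  by rewrite !btog eqxx (negbTE ij); ring.
have -> : 4 * A = A + A + A + A by lra.
rewrite {2}A1 {2}A2 {2}A3 {1}/A -!big_split/= (eq_bigr (fun=> 1)).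
  by rewrite sumr_const.
by move=> I _; ring.
Qed.

Lemma decoupling z :
  4 * \sum_(I : {set 'I_N}) gram x (restr I z) (restr (~: I)%SET z) =
  #|{set 'I_N}|%:R * offdiag z.
Proof.
rewrite offdiagE.
transitivity (4 * \sum_i \sum_j \sum_(I : {set 'I_N}) ((i \in I)%:R * (j \notin I)%:R)
               * (z 0 i * z 0 j * dotp (x i) (x j))).
  congr (_ * _); under eq_bigr do rewrite gramE.
  rewrite exchange_big/=; apply: eq_bigr => i _.
  rewrite exchange_big/=; apply: eq_bigr => j _.
  apply: eq_bigr => I _; rewrite !mxE !inE.
  by case: (i \in I); case: (j \in I) => /=; lra.
rewrite !mulr_sumr; apply: eq_bigr => i _.
rewrite !mulr_sumr [RHS]big_mkcond/=; apply: eq_bigr => j _.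
rewrite -mulr_suml mulrA; case: ifPn => [ji|]; first by rewrite card_separating.
rewrite negbK => /eqP ->; rewrite big1 ?mulr0 ?mul0r// => I _.
by case: (i \in I); rewrite ?mulr0 ?mul0r.
Qed.

Lemma offdiag_le z t :
  (forall I, `|gram x (restr I z) (restr (~: I)%SET z)| <= t) ->
  `|offdiag z| <= 4 * t.
Proof.
move=> ht; have c0 : 0 < #|{set 'I_N}|%:R :> R.
  by rewrite ltr0n; apply/card_gt0P; exists finset.set0.
rewrite -(ler_pM2l c0) -[X in X * `|_|]gtr0_norm// -normrM -decoupling.
rewrite normrM gtr0_norm// mulrCA ler_pM2l//.
apply: (le_trans (ler_norm_sum _ _ _)).
apply: (@le_trans _ _ (\sum_(I : {set 'I_N}) t)); first by apply: ler_sum.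
by rewrite sumr_const mulr_natl.
Qed.

Lemma enorm_restr_le S z : enorm (restr S z) <= enorm z.
Proof.
rewrite ler_sqrt ?dotp_ge0//; apply: ler_sum => j _; rewrite mxE.
by case: ifP => // _; rewrite mulr0 -expr2 sqr_ge0.
Qed.

Lemma restr_out S z j : j \notin S -> restr S z 0 j = 0.
Proof. by rewrite mxE => /negbTE ->. Qed.

End Decoupling.

Section Levels.
Context {R : realType} (n N m K : nat) (x : 'I_N -> 'rV[R]_n).
Hypothesis m0 : (0 < m)%N.

(* Level [k] consists of the entries with [lam k < |z_i| <= lam k.+1]; since
   [lam 0 = 0], [upper z 0] is the support of [z]. *)
Definition lam (k : nat) : R :=
  if k is k'.+1 then 4 ^+ k' / Num.sqrt m%:R else 0.

(** A unit vector has at most [m / 16^(k-1)] entries above [lam k] for [k >= 1], by Chebyshev. The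
    predecessor lets levels [0] and [1] share the value [m]. *)
Definition level_size (k : nat) : nat := m %/ 16 ^ k.-1.

Definition upper (z : 'rV[R]_N) k : {set 'I_N} := [set i | lam k < `|z 0 i|]%SET.

Let m0R : 0 < m%:R :> R. Proof. by rewrite ltr0n. Qed.
Let sq0 : 0 < Num.sqrt m%:R :> R. Proof. by rewrite sqrtr_gt0. Qed.

Lemma le_lam k : lam k <= lam k.+1.
Proof.
case: k => [|k] /=; first by rewrite divr_ge0// ltW.
rewrite ler_pM2r ?invr_gt0// exprS.
have : 0 <= 4 ^+ k :> R by rewrite exprn_ge0.
lra.
Qed.

Lemma card_upper_le (z : 'rV[R]_N) k : enorm z = 1 -> (#|supp z| <= m)%N ->
  (#|upper z k| <= level_size k)%N.
Proof.
move=> z1 zm; case: k => [|k].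
  rewrite /level_size /= expn0 divn1; apply: leq_trans zm.
  apply: subset_leq_card; apply/fintype.subsetP => j.
  by rewrite !inE normr_gt0.
rewrite /level_size /= leq_divRL ?expn_gt0// -(ler_nat R).
have : \sum_(i in upper z k.+1) (lam k.+1) ^+ 2 <= enorm z ^+ 2.
  rewrite sqr_enorm /dotp big_mkcond/=; apply: ler_sum => j _.
  rewrite -expr2; case: ifP => [|_]; last exact: sqr_ge0.
  rewrite inE => /ltW h; rewrite -[leRHS]real_normK ?num_real//.
  by rewrite lerXn2r ?nnegrE// divr_ge0 ?exprn_ge0// ltW.
rewrite sumr_const z1 expr1n /lam exprMn exprVn sqr_sqrtr ?ler0n//.
rewrite -exprM mulnC exprM -[_ *+ _]mulr_natl mulrA ler_pdivrMr// mul1r.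
have -> : 4 ^+ 2 = 16%:R :> R by rewrite -natrX.
by rewrite -natrX -natrM.
Qed.

Variables (ta : nat -> R) (tau : R).

Definition gram_bounded_on s (al t : R) : Prop :=
  forall (U V : {set 'I_N}) (u v : 'rV[R]_N),
  (#|U| <= s)%N -> (#|V| <= s)%N -> {in U, forall j, j \notin V} ->
  (forall j, j \notin U -> u 0 j = 0) -> (forall j, j \notin V -> v 0 j = 0) ->
  enorm u <= 1 -> enorm v <= 1 -> (forall j, `|u 0 j| <= al) ->
  `|gram x u v| <= t.

Hypothesis taP : forall k, (k < K)%N ->
  gram_bounded_on (level_size k) (lam k.+1) (ta k).
Hypothesis tauP : gram_bounded_on (level_size K) 1 tau.

(** Splitting [G k] into level [k] and [G k.+1], on the side of [I] and then on that of [J], writes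
    [q k] as two terms plus [q k.+1]. In each term one argument lives on level [k] and has entries
    at most [lam k.+1]; for the second term it is brought to the front by symmetry. *)
Lemma gram_restr_le (z : 'rV[R]_N) (I : {set 'I_N}) :
  enorm z = 1 -> (#|supp z| <= m)%N ->
  `|gram x (restr I z) (restr (~: I)%SET z)| <= \sum_(k < K) 2 * ta k + tau.
Proof.
move=> z1 zm; pose G := upper z.
have Gs k : (#|G k| <= level_size k)%N by exact: card_upper_le.
have GS k j : j \in G k.+1 -> j \in G k.
  by rewrite !inE; apply: le_lt_trans (le_lam k).
have subs (S1 S2 : {set 'I_N}) c : (#|S2| <= c)%N -> (#|S1 :&: S2|%SET <= c)%N.
  by apply: leq_trans; apply: subset_leq_card; apply: subsetIr.
pose J := (~: I)%SET.
pose q k := gram x (restr (I :&: G k)%SET z) (restr (J :&: G k)%SET z).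
have norm1 S : enorm (restr S z) <= 1 by rewrite -z1 enorm_restr_le.
have entry S j : `|restr S z 0 j| <= 1 by exact: norm_entry_le1.
have split S k : restr (S :&: G k)%SET z =
    restr (S :&: (G k :\: G k.+1))%SET z + restr (S :&: G k.+1)%SET z.
  apply/rowP => j; rewrite !mxE !finset.in_setI finset.in_setD.
  case: (j \in S) => /=; last by rewrite addr0.
  have [jG|jG] := boolP (j \in G k.+1); first by rewrite GS//= add0r.
  by rewrite /= addr0.
have diff k S j : `|restr (S :&: (G k :\: G k.+1))%SET z 0 j| <= lam k.+1.
  rewrite mxE !finset.in_setI finset.in_setD; case: ifP => [/and3P[_ h _]|_].
    by move: h; rewrite inE -leNgt.
  by rewrite normr0 divr_ge0 ?exprn_ge0// ltW.
have diffs k S : (#|S :&: (G k :\: G k.+1)|%SET <= level_size k)%N.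
  by apply: subs; apply: leq_trans (Gs k); apply: subset_leq_card; exact: subsetDl.
have step k : (k < K)%N -> `|q k| <= 2 * ta k + `|q k.+1|.
  move=> kK; rewrite /q (split I k).
  rewrite gramDl; apply: (le_trans (ler_normD _ _)).
  have h1 : `|gram x (restr (I :&: (G k :\: G k.+1))%SET z)
                (restr (J :&: G k)%SET z)| <= ta k.
    apply: (taP kK (U := (I :&: (G k :\: G k.+1))%SET)
                   (V := (J :&: G k)%SET)) => //.
    - exact: subs.
    - by move=> j; rewrite !inE => /andP[-> _].
    - by move=> j; exact: restr_out.
    - by move=> j; exact: restr_out.
  have -> : gram x (restr (I :&: G k.+1)%SET z) (restr (J :&: G k)%SET z) =
      gram x (restr (I :&: G k.+1)%SET z)
             (restr (J :&: (G k :\: G k.+1))%SET z) + q k.+1.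
    by rewrite (split J k) gramDr.
  have h2 : `|gram x (restr (I :&: G k.+1)%SET z)
                (restr (J :&: (G k :\: G k.+1))%SET z)| <= ta k.
    rewrite gramC.
    apply: (taP kK (U := (J :&: (G k :\: G k.+1))%SET)
                   (V := (I :&: G k.+1)%SET)) => //.
    - apply: subs; apply: leq_trans (Gs k); apply: subset_leq_card.
      by apply/fintype.subsetP => j; exact: GS.
    - by move=> j; rewrite !inE => /andP[/negbTE -> _].
    - by move=> j; exact: restr_out.
    - by move=> j; exact: restr_out.
  have := ler_normD (gram x (restr (I :&: G k.+1)%SET z)
                (restr (J :&: (G k :\: G k.+1))%SET z)) (q k.+1).
  lra.
have tele k : (k <= K)%N -> `|q 0%N| <= \sum_(l < k) 2 * ta l + `|q k|.
  elim: k => [_|k IH kK]; first by rewrite big_ord0 add0r.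
  have := IH (ltnW kK); rewrite big_ord_recr/=; have := step _ kK; lra.
have restr0 S : restr (S :&: G 0)%SET z = restr S z.
  apply/rowP => j; rewrite !mxE finset.in_setI.
  have [->|z0] := eqVneq (z 0 j) 0; first by rewrite !if_same.
  have jG : j \in G 0%N by rewrite inE normr_gt0.
  by rewrite jG andbT.
have <- : q 0%N = gram x (restr I z) (restr J z) by rewrite /q !restr0.
apply: (le_trans (tele K (leqnn K))); rewrite lerD2l.
apply: (tauP (U := (I :&: G K)%SET) (V := (J :&: G K)%SET)) => //.
- exact: subs.
- exact: subs.
- by move=> j; rewrite !inE => /andP[-> _].
- by move=> j; exact: restr_out.
- by move=> j; exact: restr_out.
Qed.

End Levels.

(** * The supremum over sparse vectors *)

Section SparseSup.
Context {R : realType} (n N m : nat).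
Implicit Types (x : 'I_N -> 'rV[R]_n) (z v : 'rV[R]_N).

Lemma offdiagZ x a z : offdiag x (a *: z) = a ^+ 2 * offdiag x z.
Proof.
rewrite !offdiagE mulr_sumr; apply: eq_bigr => i _.
rewrite mulr_sumr; apply: eq_bigr => j _; rewrite !mxE; ring.
Qed.

Lemma offdiag_sparse_le x t : 0 <= t ->
  (forall z, sparse_sphere m z -> `|offdiag x z| <= t) ->
  forall v, (#|supp v| <= m)%N -> `|offdiag x v| <= t * dotp v v.
Proof.
move=> t0 ht v vm; have [->|v0] := eqVneq v 0.
  rewrite dotp0 mulr0 offdiagE big1 ?normr0// => i _.
  by rewrite big1// => j _; rewrite !mxE !mul0r.
have e0 : enorm v != 0 by rewrite enorm_eq0.
have vE : v = enorm v *: normalize v by rewrite /normalize scalerA mulfV ?scale1r.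
rewrite -sqr_enorm {1}vE offdiagZ normrM ger0_norm ?sqr_ge0// mulrC.
rewrite ler_wpM2r ?sqr_ge0//; apply: ht; split; first exact: enorm_normalize.
apply: leq_trans vm; apply: subset_leq_card; apply/fintype.subsetP => j.
by rewrite !inE mxE mulf_eq0 negb_or => /andP[].
Qed.

(** Excludes the default value that [sup] takes on sets without a supremum. *)
Lemma has_sup_B x : (0 < m)%N -> (m <= N)%N ->
  has_sup [set Num.sqrt `|offdiag x z| | z in @sparse_sphere R N m].
Proof.
move=> m0 mN; have N0 : (0 < N)%N := leq_trans m0 mN; split.
  pose z : 'rV[R]_N := delta_mx 0 (Ordinal N0).
  exists (Num.sqrt `|offdiag x z|), z => //; split.
    rewrite /enorm /dotp (bigD1 (Ordinal N0))//= !mxE !eqxx mulr1 big1 ?addr0 ?sqrtr1//.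
    by move=> j jN; rewrite !mxE (negbTE jN) mulr0.
  apply: leq_trans m0; rewrite -(card1 (Ordinal N0)); apply: subset_leq_card.
  apply/fintype.subsetP => j; rewrite !inE mxE eqxx /=.
  by case: (j == _) => //; rewrite eqxx.
exists (Num.sqrt (\sum_(i < N) \sum_(j < N | j != i) `|dotp (x i) (x j)|)).
move=> _ [z [z1 _] <-]; rewrite ler_wsqrtr// offdiagE.
apply: (le_trans (ler_norm_sum _ _ _)); apply: ler_sum => i _.
apply: (le_trans (ler_norm_sum _ _ _)); apply: ler_sum => j _.
by rewrite !normrM ler_piMl// mulr_ile1// norm_entry_le1 ?z1.
Qed.

Lemma B_ge0 x : (0 < m)%N -> (m <= N)%N -> 0 <= B_ m x.
Proof.
move=> m0 mN; have sB := has_sup_B x m0 mN; have [[_ [z zS _]] _] := sB.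
apply: (@le_trans _ _ (Num.sqrt `|offdiag x z|)); first exact: sqrtr_ge0.
by apply: sup_upper_bound => //; exists z.
Qed.

Lemma sqr_B_le x t : (0 < m)%N -> (m <= N)%N -> 0 <= t ->
  B_ m x ^+ 2 <= t <-> forall z, sparse_sphere m z -> `|offdiag x z| <= t.
Proof.
move=> m0 mN t0; have sB := has_sup_B x m0 mN; split=> [Bt z zS|ht].
  apply: le_trans Bt.
  have h : Num.sqrt `|offdiag x z| <= B_ m x.
    by apply: sup_upper_bound => //; exists z.
  rewrite -[leLHS]sqr_sqrtr// lerXn2r ?nnegrE ?sqrtr_ge0//.
  exact: B_ge0.
have h : B_ m x <= Num.sqrt t.
  apply: ge_sup; first by case: sB.
  by move=> _ [z zS <-]; rewrite ler_wsqrtr// ht.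
rewrite -[leRHS](sqr_sqrtr t0) lerXn2r ?nnegrE ?sqrtr_ge0//.
exact: B_ge0.
Qed.

Lemma cvg_finsum (I : Type) (s : seq I) (p : pred I) (f : I -> nat -> R) l :
  (forall i, f i k @[k --> \oo] --> l i) ->
  (\sum_(i <- s | p i) f i k) @[k --> \oo] --> \sum_(i <- s | p i) l i.
Proof.
by move=> fl; apply: cvg_big => // -[a b]; exact: add_continuous.
Qed.

Definition int_row (q : {ffun 'I_N -> int}) : 'rV[R]_N := \row_j (q j)%:~R.

(* By homogeneity the unit sphere may be replaced by the integer vectors. *)
Lemma offdiag_int_row x t : 0 <= t ->
  (forall q, (#|supp (int_row q)| <= m)%N ->
     `|offdiag x (int_row q)| <= t * dotp (int_row q) (int_row q)) ->
  forall z, sparse_sphere m z -> `|offdiag x z| <= t.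
Proof.
move=> t0 ht z [z1 zm].
(* Rounding [(k + 1) z] down and dividing by [k + 1] converges to [z]; zero entries stay zero, so
   sparsity is kept. *)
pose q k : {ffun 'I_N -> int} := [ffun j => Num.floor (z 0 j * k.+1%:R)].
pose v k : 'rV[R]_N := k.+1%:R^-1 *: int_row (q k).
have k0 (k : nat) : 0 < k.+1%:R :> R by rewrite ltr0n.
have vz j : v k 0 j @[k --> \oo] --> z 0 j.
  apply: (@squeeze_cvgr _ _ _ _ (fun k => z 0 j - harmonic k) (cst (z 0 j))).
  - apply: nearW => k; rewrite !mxE ffunE /harmonic /=.
    have /andP[a b] := floor_itv (z 0 j * k.+1%:R).
    rewrite -[X in X - _](mulfK (lt0r_neq0 (k0 k)) (z 0 j)).
    rewrite [k.+1%:R^-1 * _]mulrC -[X in _ - X]mul1r -mulrBl.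
    rewrite !ler_pM2r ?invr_gt0//; rewrite intrD in b; apply/andP; split; first lra.
    by rewrite ler_pdivrMr.
  - rewrite -[X in _ --> X]subr0; apply: cvgB; [exact: cvg_cst|exact: cvg_harmonic].
  - exact: cvg_cst.
have dotv : dotp (v k) (v k) @[k --> \oo] --> (1 : R).
  have -> : 1 = dotp z z by rewrite -sqr_enorm z1 expr1n.
  by apply: cvg_finsum => j; apply: cvgM.
have offv : offdiag x (v k) @[k --> \oo] --> offdiag x z.
  under eq_fun do rewrite offdiagE.
  rewrite offdiagE; apply: cvg_finsum => i; apply: cvg_finsum => j.
  by apply: cvgM; [exact: (cvgM (vz i) (vz j))|exact: cvg_cst].
rewrite -[leRHS]mulr1; apply: (ler_cvg_to (cvg_norm offv) (cvgM (cvg_cst t) dotv)).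
apply: nearW => k /=; rewrite offdiagZ normrM ger0_norm ?sqr_ge0//.
rewrite dotpZr dotpC dotpZr mulrA mulrCA -expr2 ler_wpM2l ?sqr_ge0//.
apply: ht; apply: leq_trans zm; apply: subset_leq_card.
apply/fintype.subsetP => j; rewrite !inE mxE ffunE.
by apply: contra => /eqP ->; rewrite mul0r floor0.
Qed.

(** The supremum is over an uncountable set, but by [offdiag_int_row] the complement of the event is
    a countable union over sparse integer vectors. *)
Lemma measurable_B_le d (T : measurableType d) (x : T -> 'I_N -> 'rV[R]_n) t :
  (0 < m)%N -> (m <= N)%N -> 0 <= t -> (forall i, measurable_row (x ^~ i)) ->
  measurable [set w | B_ m (x w) ^+ 2 <= t].
Proof.
move=> m0 mN t0 mx.
rewrite (_ : [set w | _] = ~` \bigcup_(q in [set: {ffun 'I_N -> int}])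
  (if (#|supp (int_row q)| <= m)%N then
    [set w | t * dotp (int_row q) (int_row q) < `|offdiag (x w) (int_row q)|]
   else set0)).
  apply: measurableC; apply: countable_bigcupT_measurable => [|q].
    exact: countableP.
  case: ifP => // _; apply: measurable_set_lt => //.
  apply: measurableT_comp => //; apply: measurable_funB.
    apply: measurable_funX; apply: measurable_enorm.
    exact: measurable_lincomb.
  apply: measurable_sum => i; apply: measurable_funM => //.
  by apply: measurable_funX; apply: measurable_enorm.
apply/seteqP; split => w /=.
  move/(proj1 (sqr_B_le _ m0 mN t0)) => h [q _]; case: ifP => // qm.
  by rewrite /= ltNge (offdiag_sparse_le t0 h).
move=> h; apply/(sqr_B_le _ m0 mN t0); apply: offdiag_int_row => // q qm.
by rewrite leNgt; apply/negP => hq; apply: h; exists q => //; rewrite qm.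
Qed.

End SparseSup.

(** * The inequality for [B_] where all net bounds hold *)

Section Deterministic.
Context {R : realType} (n N m K : nat) (x : 'I_N -> 'rV[R]_n).
Hypotheses (m0 : (0 < m)%N) (mN : (m <= N)%N).
Variables (b tt : R) (tk : nat -> R).
Hypothesis xb : forall i, enorm (x i) <= b.
Hypotheses (tk0 : forall k, 0 <= tk k) (tt0 : 0 <= tt).
Hypothesis size_gt0 : forall k, (k <= K)%N -> (0 < level_size m k)%N.
Hypothesis le_size_lam : forall k, (k < K)%N ->
  (Num.sqrt (level_size m k)%:R)^-1 <= lam m k.+1 :> R.
Hypothesis tkP : forall k, (k < K)%N ->
  forall p : grid_index N (level_size m k) * grid_index N (level_size m k),
  good_pair (lam m k.+1 : R) p ->
  `|gram x (grid R p.1) (grid R p.2)| <= tk k * enorm (lincomb x (grid R p.2)).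
Hypothesis ttP :
  forall p : grid_index N (level_size m K) * grid_index N (level_size m K),
  good_pair (1 : R) p ->
  `|gram x (grid R p.1) (grid R p.2)| <= tt * enorm (lincomb x (grid R p.2)).

Let b0 : 0 <= b.
Proof. by apply: le_trans (xb (Ordinal (leq_trans m0 mN))); exact: enorm_ge0. Qed.

Lemma enorm_lincomb_sparse_le v : (#|supp v| <= m)%N -> enorm v <= 1 ->
  enorm (lincomb x v) <= Num.sqrt (b ^+ 2 + B_ m x ^+ 2).
Proof.
move=> vm v1.
have v2 : dotp v v <= 1 by rewrite -sqr_enorm expr_le1// enorm_ge0.
have B0 : 0 <= B_ m x ^+ 2 by exact: sqr_ge0.
have off : `|offdiag x v| <= B_ m x ^+ 2.
  have := offdiag_sparse_le B0 (proj1 (sqr_B_le x m0 mN B0) (lexx _)) vm.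
  by move=> /le_trans; apply; rewrite ler_piMr.
rewrite /enorm ler_wsqrtr// -sqr_enorm.
have -> : enorm (lincomb x v) ^+ 2 =
    offdiag x v + \sum_(i < N) v 0 i ^+ 2 * enorm (x i) ^+ 2.
  by rewrite /offdiag subrK.
rewrite addrC lerD//; last by move: off; rewrite ler_norml => /andP[].
apply: (@le_trans _ _ (\sum_(i < N) v 0 i ^+ 2 * b ^+ 2)).
  apply: ler_sum => i _; rewrite ler_wpM2l ?sqr_ge0//.
  by rewrite lerXn2r ?nnegrE ?enorm_ge0.
rewrite -mulr_suml; apply: ler_piMl; first exact: sqr_ge0.
by apply: le_trans v2; rewrite /dotp; apply: ler_sum => i _; rewrite expr2.
Qed.

(** [64 = 4 * 16]: decoupling costs [4], the passage from the nets [16]. One [A] bounds [|X v|] on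
    all levels, because every level size is at most [m]. *)
Lemma sqr_B_le_of_nets :
  B_ m x ^+ 2 <= 64 * (\sum_(k < K) 2 * tk k + tt)
                   * Num.sqrt (b ^+ 2 + B_ m x ^+ 2).
Proof.
set A := Num.sqrt _; have A0 : 0 <= A by exact: sqrtr_ge0.
have sum0 : 0 <= \sum_(k < K) 2 * tk k + tt.
  by rewrite addr_ge0// sumr_ge0// => k _; rewrite mulr_ge0.
have AP s (v : 'rV[R]_N) : (s <= m)%N -> (#|supp v| <= s)%N -> enorm v <= 1 ->
    enorm (lincomb x v) <= A.
  by move=> sm vs; apply: enorm_lincomb_sparse_le; exact: leq_trans sm.
have sm k : (level_size m k <= m)%N by exact: leq_div.
have s1 k : (k <= K)%N -> (Num.sqrt (level_size m k)%:R)^-1 <= 1 :> R.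
  move=> /size_gt0 s0; rewrite invf_le1 ?sqrtr_gt0 ?ltr0n//.
  by rewrite -[leLHS]sqrtr1 ler_wsqrtr// ler1n.
apply/(sqr_B_le _ m0 mN).
  by rewrite mulr_ge0// mulr_ge0.
move=> z [z1 zm].
have -> : 64 * (\sum_(k < K) 2 * tk k + tt) * A =
    4 * (\sum_(k < K) 2 * (16 * (tk k * A)) + 16 * (tt * A)).
  rewrite [in RHS](eq_bigr (fun k : 'I_K => (2 * tk k) * (16 * A))); last first.
    by move=> k _; ring.
  by rewrite -mulr_suml; ring.
apply: offdiag_le => I.
apply: (@gram_restr_le _ _ _ m K x m0 (fun k => 16 * (tk k * A))) => //.
  move=> k kK U V u v Us Vs UV uU vV u1 v1 ual.
  apply: (gram_le_of_net (size_gt0 (ltnW kK)) (le_size_lam kK) (s1 _ (ltnW kK))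
           (tk0 k) (tkP kK) _ Us Vs) => // c cs c1.
  exact: AP (sm k) cs c1.
move=> U V u v Us Vs UV uU vV u1 v1 ual.
apply: (gram_le_of_net (size_gt0 (leqnn K)) (s1 _ (leqnn K)) (s1 _ (leqnn K))
         tt0 ttP _ Us Vs) => // c cs c1.
exact: AP (sm K) cs c1.
Qed.

End Deterministic.

(** * Entropy against tail exponents *)

Section Arithmetic.
Context {R : realType}.

(** Only [L] enters through its exact [r]-th root. For [C] and [a], which are at least [1], the
    power [r >= 1] is bounded below by the first power, so the constants do not depend on [r]. *)
Lemma le_powR_scaled (C K L a r : R) : 1 <= r -> 1 <= C -> 1 <= K -> 1 <= L ->
  1 <= a -> C * (K `^ r * L * a) <= (C * K * L `^ r^-1 * a) `^ r.
Proof.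
move=> r1 C1 K1 L1 a1; have r0 : r != 0 by rewrite gt_eqF// (lt_le_trans ltr01 r1).
rewrite !powRM ?mulr_ge0 ?powR_ge0 ?(le_trans ler01)//.
rewrite -powRrM mulVf// powRr1 ?(le_trans ler01)//.
rewrite !mulrA; apply: ler_pM => //.
- by rewrite !mulr_ge0 ?powR_ge0 ?(le_trans ler01).
- by rewrite (le_trans ler01).
- rewrite ler_wpM2r ?(le_trans ler01)// ler_wpM2r ?powR_ge0//.
  exact: le1r_powR.
- exact: le1r_powR.
Qed.

(** [s] is at least [m / (2 * 16^k)]. The factors [2] from here and from [1 + N / s <= 2 N / s] are
    absorbed by [1 / theta], and [4 k] comes from [16 <= expR 4]. *)
Lemma ln_grid_le (N m s k : nat) (theta : R) : (0 < m)%N -> (m <= N)%N ->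
  (s <= N)%N -> (0 < s)%N -> 0 < theta -> theta < 1 / 4 ->
  (m <= 2 * s * 16 ^ k)%N ->
  ln (1 + N%:R / s%:R) <= ln (2 * N%:R / (theta * m%:R)) + 4 * k%:R :> R.
Proof.
move=> m0 mN sN s0 t0 t4 ms.
have m0R : 0 < m%:R :> R by rewrite ltr0n.
have s0R : 0 < s%:R :> R by rewrite ltr0n.
have N0R : 0 < N%:R :> R by rewrite ltr0n (leq_trans m0).
have q0 : 0 < 2 * N%:R / (theta * m%:R) by rewrite divr_gt0 ?mulr_gt0.
have l0 : 0 < 1 + N%:R / s%:R :> R by rewrite addr_gt0// divr_gt0.
rewrite -[leRHS]expRK ler_ln ?posrE ?expR_gt0//.
rewrite expRD lnK//.
have e16 : 16 ^+ k <= expR (4 * k%:R) :> R.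
  rewrite mulrC expRM_natl lerXn2r ?nnegrE ?expR_ge0//.
  have -> : 16 = 2 ^+ 4 :> R by rewrite -natrX.
  have -> : (4 : R) = 4 * 1 by rewrite mulr1.
  rewrite expRM_natl lerXn2r ?nnegrE ?expR_ge0//.
  by apply: le_trans (expR_ge1Dx _); lra.
apply: (@le_trans _ _ (2 * N%:R / (theta * m%:R) * 16 ^+ k)); last first.
  by rewrite ler_pM2l.
apply: (@le_trans _ _ (2 * N%:R / s%:R)).
  have : 1 <= N%:R / s%:R :> R by rewrite ler_pdivlMr// mul1r ler_nat.
  by rewrite -mulrA; lra.
rewrite -!mulrA ler_wpM2l// ler_wpM2l ?(ltW N0R)//.
rewrite mulrC ler_pdivlMr ?mulr_gt0// mulrC ler_pdivrMr//.
have : m%:R <= 2 * s%:R * 16 ^+ k :> R by rewrite -natrX -!natrM ler_nat.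
have : 0 <= 16 ^+ k :> R by rewrite exprn_ge0.
have : theta * m%:R <= 4^-1 * m%:R by rewrite ler_pM2r//; lra.
nra.
Qed.

(** [L >= 1] puts the left side below [32 s (1 + k) L], and [1 + k <= 2^k] turns [s <= c m / 16^k]
    into [c m / 8^k]. The factor [c] is [16] on the levels up to [K] and [1] on the last one. *)
Lemma entropy_le (N m s k c : nat) (theta : R) : (0 < m)%N -> (m <= N)%N ->
  (s <= N)%N -> (0 < s)%N -> 0 < theta -> theta < 1 / 4 ->
  (m <= 2 * s * 16 ^ k)%N -> (s * 16 ^ k <= c * m)%N ->
  1 <= ln (2 * N%:R / (theta * m%:R)) :> R ->
  8 * s%:R * ln (1 + N%:R / s%:R) + 2 * s%:R
    <= 32 * c%:R * (ln (2 * N%:R / (theta * m%:R)) * (m%:R / 8 ^+ k)) :> R.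
Proof.
move=> m0 mN sN s0 t0 t4 ms sm L1.
have hln := ln_grid_le m0 mN sN s0 t0 t4 ms.
set L := ln (2 * _ / _) in L1 hln *.
have s0R : 0 < s%:R :> R by rewrite ltr0n.
have k0 : 0 <= k%:R :> R by rewrite ler0n.
have k2 : 1 + k%:R <= 2 ^+ k :> R.
  by rewrite nat1r -natrX ler_nat ltn_expl.
have smR : s%:R * 16 ^+ k <= c%:R * m%:R :> R by rewrite -natrX -!natrM ler_nat.
have p8 : 0 < 8 ^+ k :> R by rewrite exprn_gt0.
have e16 : 16 ^+ k = 2 ^+ k * 8 ^+ k :> R by rewrite -exprMn; congr (_ ^+ _); lra.
apply: (@le_trans _ _ (32 * (s%:R * 2 ^+ k) * L)).
  apply: (@le_trans _ _ (32 * (s%:R * (1 + k%:R)) * L)).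
    have : s%:R * ln (1 + N%:R / s%:R) <= s%:R * (L + 4 * k%:R) by rewrite ler_pM2l.
    have : 0 <= s%:R * k%:R * (L - 1).
      by rewrite mulr_ge0 ?subr_ge0// mulr_ge0// ltW.
    have : 0 <= s%:R * (L - 1) by rewrite mulr_ge0 ?subr_ge0// ltW.
    nra.
  by rewrite ler_wpM2r ?(le_trans ler01)// ler_pM2l// ler_pM2l.
have -> : 32 * c%:R * (L * (m%:R / 8 ^+ k)) = 32 * (c%:R * m%:R / 8 ^+ k) * L.
  by ring.
rewrite ler_wpM2r ?(le_trans ler01)// ler_pM2l// ler_pdivlMr//.
by rewrite -mulrA -e16.
Qed.

End Arithmetic.

(** * The probability of the bad event *)

Section PsiVector.
Context d (T : measurableType d) (R : realType) (P : probability T R).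
Context (n : nat) (X : {RV P >-> n.-tuple R}) (r : R).
Hypothesis r1 : 1 <= r.

Lemma enorm_delta_mx (j : 'I_n) : enorm (delta_mx 0 j : 'rV[R]_n) = 1.
Proof.
rewrite /enorm /dotp (bigD1 j)//= !mxE !eqxx mulr1 big1 ?addr0 ?sqrtr1//.
by move=> k kj; rewrite !mxE (negbTE kj) mulr0.
Qed.

(** In dimension [0] the sphere is empty and the supremum is [-oo]. *)
Lemma psi_vnorm_ge0 : (0 < n)%N ->
  (0 <= psi_vnorm P r (fun w => tuple_row (X w)))%E.
Proof.
move=> n0; pose y : 'rV[R]_n := delta_mx 0 (Ordinal n0).
apply: (@le_trans _ _ (psi_norm P r (fun w => dotp (tuple_row (X w)) y))).
  by apply: le_ereal_inf_tmp => _ [C [C0 _] <-]; rewrite lee_fin ltW.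
by apply: ereal_sup_ubound; exists y => //; exact: enorm_delta_mx.
Qed.

(** The strict inequality supplies an admissible scale below [c], and the integrand decreases in the
    scale; this avoids asking whether the infimum is attained. *)
Lemma psi_vnorm_lt_integral (c : R) :
  (psi_vnorm P r (fun w => tuple_row (X w)) < c%:E)%E ->
  forall y, enorm y = 1 ->
  (\int[P]_w (expR ((`|dotp (tuple_row (X w)) y| / c) `^ r))%:E <= 2%:E)%E.
Proof.
move=> hc y y1.
have : (psi_norm P r (fun w => dotp (tuple_row (X w)) y) < c%:E)%E.
  by apply: le_lt_trans hc; apply: ereal_sup_ubound; exists y.
move=> /ereal_inf_lt[_ [C [C0 +] <-]]; rewrite lte_fin unlock => hC Cc.
have mexp (a : R) : measurable_fun setT
    (fun w => expR ((`|dotp (tuple_row (X w)) y| / a) `^ r)).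
  apply: measurableT_comp => //; apply: (measurableT_comp (measurable_powR _)).
  apply: measurable_funM => //; apply: measurableT_comp => //.
  exact: measurable_dotp_tuple_row.
apply: le_trans hC; apply: ge0_le_integral => //.
- exact/measurable_EFinP.
- exact/measurable_EFinP.
- move=> w _; rewrite lee_fin ler_expR.
  have c0 : 0 < c := lt_trans C0 Cc.
  apply: ge0_ler_powR; first exact: le_trans ler01 r1.
  - by rewrite nnegrE divr_ge0// ltW.
  - by rewrite nnegrE divr_ge0// ltW.
  - by rewrite ler_wpM2l// lef_pV2 ?posrE// ltW.
Qed.

(** Centering is given by coordinates; adding up the coordinates needs their integrability, which
    follows from the psi_r bound in the coordinate directions. *)
Lemma integral_dotp_eq0 (c : R) : 0 < c ->
  (psi_vnorm P r (fun w => tuple_row (X w)) < c%:E)%E ->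
  (forall j, 'E_P[fun w => tuple_row (X w) ord0 j] = 0)%E ->
  forall y, (\int[P]_w (dotp (tuple_row (X w)) y)%:E = 0)%E.
Proof.
move=> c0 hc EX y.
have ij j : P.-integrable setT (fun w => (tuple_row (X w) 0 j)%:E).
  have h := psi_vnorm_lt_integral hc (enorm_delta_mx j).
  have dj w : dotp (tuple_row (X w)) (delta_mx 0 j) = tuple_row (X w) 0 j.
    rewrite /dotp (bigD1 j)//= [delta_mx _ _ _ _]mxE !eqxx mulr1 big1 ?addr0//.
    by move=> k kj; rewrite [delta_mx _ _ _ _]mxE (negbTE kj) mulr0.
  have iZ : P.-integrable setT (EFin \o (fun w => dotp (tuple_row (X w)) (delta_mx 0 j) / c)).
    apply: (@integrable_of_psi _ _ _ P _ r _ r1).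
      by apply: measurable_funM; [exact: measurable_dotp_tuple_row|exact: measurable_cst].
    under eq_integral do rewrite normrM [`|c^-1|]gtr0_norm ?invr_gt0//.
    exact: h.
  apply: eq_integrable (integrableZl measurableT c iZ) => // w _.
  by rewrite /= dj -EFinM mulrC divfK// gt_eqF.
transitivity (\int[P]_w (\sum_(j < n) (y 0 j)%:E * (tuple_row (X w) 0 j)%:E))%E.
  apply: eq_integral => w _; rewrite sumEFin; congr EFin.
  by apply: eq_bigr => j _; rewrite mulrC.
rewrite integral_sum//; last by move=> j; exact: integrableZl.
rewrite big1// => j _; rewrite integralZl//.
by have := EX j; rewrite unlock => ->; rewrite mule0.
Qed.

End PsiVector.

Lemma measurable_bigmaxr d (T : measurableType d) (R : realType) (I : Type)
    (s : seq I) (f : I -> T -> R) : (forall i, measurable_fun setT (f i)) ->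
  measurable_fun setT (fun w => \big[Num.max/0]_(i <- s) f i w).
Proof.
move=> mf; elim: s => [|i s IH].
  by under eq_fun do rewrite big_nil; exact: measurable_cst.
by under eq_fun do rewrite big_cons; exact: measurable_maxr.
Qed.

Section LevelSizes.
Variables (m K : nat).
Hypotheses (m0 : (0 < m)%N) (Km : (64 ^ K <= m)%N).

Lemma exp_pred_le k : (k <= K.+1)%N -> (16 ^ k.-1 <= m)%N.
Proof.
move=> kK; apply: leq_trans Km; apply: (@leq_trans (64 ^ k.-1)).
  by case: k.-1 => // e; rewrite leq_exp2r.
by rewrite leq_pexp2l// -subn1 leq_subLR add1n.
Qed.

Lemma level_size_gt0 k : (k <= K.+1)%N -> (0 < level_size m k)%N.
Proof. by move=> kK; rewrite divn_gt0 ?expn_gt0// exp_pred_le. Qed.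

(** Rounding down a quotient that is at least [1] loses at most a factor [2]. *)
Lemma le_double_level_size_mul k : (k <= K)%N ->
  (m <= 2 * level_size m k.+1 * 16 ^ k)%N.
Proof.
move=> kK; have s0 : (0 < level_size m k.+1)%N by exact: level_size_gt0.
rewrite /level_size /= in s0 *.
rewrite [leqLHS](divn_eq m (16 ^ k)) -mulnA mul2n -addnn leq_add2l.
by apply: leq_trans (ltnW (ltn_pmod _ _)) _; rewrite ?expn_gt0 ?leq_pmull.
Qed.

Lemma le_level_size_mul k : (k <= K)%N -> (m <= level_size m k * 16 ^ k)%N.
Proof.
case: k => [|k] kK; first by rewrite /level_size /= expn0 divn1 muln1.
apply: leq_trans (le_double_level_size_mul (ltnW kK)) _.
by rewrite expnS mulnA leq_mul2r mulnC leq_mul2l !orbT.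
Qed.

Lemma level_size_mul_le k : (level_size m k * 16 ^ k <= 16 * m)%N.
Proof.
case: k => [|k]; rewrite /level_size /= ?expn0 ?divn1 ?muln1 ?leq_pmull//.
by rewrite expnS mulnCA leq_mul2l leq_trunc_div.
Qed.

(** Fits the mesh of the net to the entry bound: a doubled rounding error stays within
    [lam m k.+1]. *)
Lemma sqrt_level_size_le (R : realType) k : (k <= K)%N ->
  (Num.sqrt (level_size m k)%:R)^-1 <= lam m k.+1 :> R.
Proof.
move=> kK; have s0 := level_size_gt0 (leqW kK).
have m0R : 0 < m%:R :> R by rewrite ltr0n.
rewrite /lam -[leLHS]mul1r ler_pdivrMr ?sqrtr_gt0 ?ltr0n//.
rewrite mulrAC ler_pdivlMr ?sqrtr_gt0// mul1r.
rewrite -(@ler_pXn2r _ 2)// ?nnegrE ?sqrtr_ge0 ?mulr_ge0 ?exprn_ge0//.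
rewrite exprMn !sqr_sqrtr ?ler0n// -exprM mulnC exprM.
have -> : 4 ^+ 2 = 16%:R :> R by rewrite -natrX.
by rewrite -natrX -natrM ler_nat mulnC le_level_size_mul.
Qed.

Lemma exp8_le_sqrt (R : realType) k : (k <= K)%N -> 8 ^+ k <= Num.sqrt m%:R :> R.
Proof.
move=> kK; rewrite -(@ler_pXn2r _ 2)// ?nnegrE ?sqrtr_ge0 ?exprn_ge0//.
rewrite sqr_sqrtr ?ler0n// -exprM mulnC exprM.
have -> : 8 ^+ 2 = 64%:R :> R by rewrite -natrX.
by rewrite -natrX ler_nat; apply: leq_trans Km; rewrite leq_pexp2l.
Qed.

End LevelSizes.

Section BadEvent.
Context d (T : measurableType d) (R : realType) (P : probability T R).
Context (n m N K : nat) (X : 'I_N -> {RV P >-> n.-tuple R}).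
Variables (r psi theta kap : R).
Hypothesis indX : independent_RV X.
Hypotheses (r1 : 1 <= r) (r2 : r <= 2) (psi0 : 0 < psi).
Hypothesis psiX : forall i y, enorm y = 1 ->
  (\int[P]_w (expR ((`|dotp (tuple_row (X i w)) y| / psi) `^ r))%:E <= 2%:E)%E.
Hypothesis centX : forall i y,
  (\int[P]_w (dotp (tuple_row (X i w)) y)%:E = 0)%E.
Hypotheses (m0 : (0 < m)%N) (mN : (m <= N)%N).
Hypotheses (Km : (64 ^ K <= m)%N) (mK : (m < 64 ^ K.+1)%N).
Hypotheses (theta0 : 0 < theta) (theta4 : theta < 1 / 4) (kap1 : 1 <= kap).

Let L : R := ln (2 * N%:R / (theta * m%:R)).
Hypothesis L1 : 1 <= L.

(* [512 * al ^+ 2] is the denominator of the tail exponent; of the factor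
   [515], the net uses [512], the two signs [1], and [2] remain. *)
Variable C0 : R.
Hypothesis C0E : C0 = 515 * 512.

Definition scale_tail : R := C0 * kap * L `^ r^-1.

Definition bad_event : set T :=
  \big[setU/set0]_(k < K.+1)
     level_bad X psi (level_size m k) (lam m k.+1) (scale_tail * 2 ^+ k)
  `|` level_bad X psi (level_size m K.+1) 1 (scale_tail * Num.sqrt m%:R).

Let m0R : 0 < m%:R :> R. Proof. by rewrite ltr0n. Qed.
Let sq0 : 0 < Num.sqrt m%:R :> R. Proof. by rewrite sqrtr_gt0. Qed.
Let sq1 : 1 <= Num.sqrt m%:R :> R.
Proof. by rewrite -[leLHS]sqrtr1 ler_wsqrtr// ler1n. Qed.
Let sq2 : Num.sqrt m%:R ^+ 2 = m%:R :> R. Proof. by rewrite sqr_sqrtr// ltW. Qed.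
Let N0 : (0 < N)%N. Proof. exact: leq_trans mN. Qed.
Let kapr1 : 1 <= kap `^ r.
Proof. by apply: le_trans (le1r_powR kap1 r1). Qed.

Let scale_tail1 : 1 <= scale_tail.
Proof.
have h : 1 <= L `^ r^-1.
  have e0 : 0 <= r^-1 by rewrite invr_ge0 (le_trans ler01).
  by have := ler_powR L1 e0; rewrite powRr0.
by rewrite !mulr_ege1// C0E; lra.
Qed.

Lemma measurable_bad_event : measurable bad_event.
Proof.
apply: measurableU; last exact: measurable_level_bad.
by apply: bigsetU_measurable => k _; exact: measurable_level_bad.
Qed.

Let D := kap `^ r * L * Num.sqrt m%:R.

(** With [al = 4^k / sqrt m], [al^2 Dk] equals [kap^r L 2^k], which is what [le_powR_scaled] gives
    for [M = scale_tail * 2^k]. Then [Dk >= D] because [8^k <= sqrt m]. *)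
Lemma level_event_le (k : nat) : (k <= K)%N ->
  (P (level_bad X psi (level_size m k) (lam m k.+1) (scale_tail * 2 ^+ k))
     <= (expR (- (2 * D)))%:E)%E.
Proof.
move=> kK; have p2 : 1 <= 2 ^+ k :> R by rewrite exprn_ege1//; lra.
have p8 : 0 < 8 ^+ k :> R by rewrite exprn_gt0.
have kL1 : 1 <= kap `^ r * L by rewrite mulr_ege1.
have s0 := level_size_gt0 Km (leqW kK).
pose Dk := kap `^ r * L * (m%:R / 8 ^+ k).
have DDk : D <= Dk.
  rewrite /D /Dk ler_wpM2l ?(le_trans ler01)// ler_pdivlMr// -[leRHS]sq2 expr2.
  by rewrite ler_pM2l// (exp8_le_sqrt Km R kK).
have D1 : 1 <= D by rewrite /D mulr_ege1.
apply: (@le_trans _ _ (expR (- (2 * Dk)))%:E); last first.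
  by rewrite lee_fin ler_expR; lra.
apply: (level_bad_le indX r1 r2 psi0 psiX centX N0 s0).
- by rewrite mulr_ege1.
- by rewrite /lam divr_gt0// exprn_gt0.
- by rewrite (le_trans D1).
- apply: (@le_trans _ _ (32 * 16%:R * (L * (m%:R / 8 ^+ k)))).
    apply: (entropy_le (c := 16)) => //.
    + by apply: leq_trans mN; exact: leq_div.
    + have := le_level_size_mul Km kK.
      by rewrite -mulnA => /leq_trans; apply; rewrite leq_pmull.
    + exact: level_size_mul_le.
  have -> : 512 * Dk = kap `^ r * (32 * 16%:R * (L * (m%:R / 8 ^+ k))).
    by rewrite /Dk; ring.
  by apply: ler_peMl => //; rewrite !mulr_ge0 ?(le_trans ler01 L1)// ?invr_ge0 ?ltW.
- have := le_powR_scaled r1 (_ : 1 <= C0) kap1 L1 p2.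
  rewrite -/scale_tail => h; apply: le_trans (h _); last by rewrite C0E; lra.
  rewrite /lam exprMn exprVn sq2 -exprM mulnC exprM.
  have -> : 4 ^+ 2 = 2 * 8 :> R by lra.
  rewrite exprMn C0E /Dk le_eqVlt; apply/orP; left; apply/eqP; field.
  by rewrite !gt_eqF.
Qed.

(** [m < 64^(K+1)] gives [m / 8^K <= 8 sqrt m], so the entropy is at most [256 D]. *)
Lemma top_event_le :
  (P (level_bad X psi (level_size m K.+1) 1 (scale_tail * Num.sqrt m%:R))
     <= (expR (- (2 * D)))%:E)%E.
Proof.
have p8 : 0 < 8 ^+ K :> R by rewrite exprn_gt0.
have kL1 : 1 <= kap `^ r * L by rewrite mulr_ege1.
have s0 := level_size_gt0 Km (leqnn K.+1).
have D1 : 1 <= D by rewrite /D mulr_ege1.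
have mle : m%:R / 8 ^+ K <= 8 * Num.sqrt m%:R :> R.
  rewrite ler_pdivrMr// -{1}sq2 expr2 mulrAC -exprS ler_pM2r//.
  rewrite -(@ler_pXn2r _ 2)// ?nnegrE ?sqrtr_ge0 ?exprn_ge0// sq2.
  rewrite -exprM mulnC exprM.
  have -> : 8 ^+ 2 = 64%:R :> R by rewrite -natrX.
  by rewrite -natrX ler_nat ltnW.
apply: (level_bad_le indX r1 r2 psi0 psiX centX N0 s0).
- by rewrite mulr_ege1.
- exact: ltr01.
- exact: D1.
- apply: (@le_trans _ _ (32 * 1%:R * (L * (m%:R / 8 ^+ K)))).
    apply: (entropy_le (c := 1)) => //.
    + by apply: leq_trans mN; exact: leq_div.
    + exact: le_double_level_size_mul (leqnn K).
    + by rewrite mul1n leq_trunc_div.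
  apply: (@le_trans _ _ (32 * 1%:R * (L * (8 * Num.sqrt m%:R)))).
    by rewrite ler_pM2l ?mulr1// ler_wpM2l// (le_trans ler01).
  have : L * Num.sqrt m%:R <= D.
    by rewrite /D -mulrA ler_peMl// mulr_ge0 ?(le_trans ler01 L1)// ltW.
  have := D1; lra.
- have := le_powR_scaled r1 (_ : 1 <= C0) kap1 L1 sq1.
  rewrite -/scale_tail => h; apply: le_trans (h _); last by rewrite C0E; lra.
  by rewrite C0E /D expr1n mulr1.
Qed.

(** Half of the exponent [2 D] pays for the [K + 2] events, as
    [K + 2 <= 1 + 8^K <= 1 + sqrt m <= expR D]. *)
Lemma bad_event_le : (P bad_event <= (expR (- D))%:E)%E.
Proof.
have kL1 : 1 <= kap `^ r * L by rewrite mulr_ege1.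
have mlev k := measurable_level_bad X psi (level_size m k) (lam m k.+1)
                 (scale_tail * 2 ^+ k).
apply: (le_trans (measureU2 P _ _)).
- by apply: bigsetU_measurable => k _; exact: mlev.
- exact: measurable_level_bad.
apply: (@le_trans _ _ (\sum_(k < K.+1) (expR (- (2 * D)))%:E
                       + (expR (- (2 * D)))%:E)%E).
  apply: leeD; last exact: top_event_le.
  apply: (le_trans (proj2 (measure_bigsetU_le P _ _ (fun k : 'I_K.+1 => mlev k)))).
  by apply: lee_sum => k _; apply: level_event_le; rewrite -ltnS.
rewrite sumEFin -EFinD lee_fin sumr_const card_ord -mulrSr -[_ *+ _]mulr_natl.
have -> : - (2 * D) = - D - D by lra.
rewrite expRD mulrA ler_piMl ?expR_ge0//.
rewrite expRN ler_pdivrMr ?expR_gt0// mul1r; apply: le_trans (expR_ge1Dx _).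
apply: (@le_trans _ _ (1 + Num.sqrt m%:R)); last first.
  by rewrite lerD2l /D ler_peMl// ltW.
have := exp8_le_sqrt Km R (leqnn K).
have : K.+1%:R <= 8 ^+ K :> R by rewrite -natrX ler_nat ltn_expl.
by rewrite -[K.+2%:R]natr1; lra.
Qed.

End BadEvent.

(** * Summation over the levels and conclusion *)

Lemma sum_geometric_half {R : realType} K : \sum_(k < K) (2 ^+ k)^-1 <= 2 :> R.
Proof.
suff : \sum_(k < K) (2 ^+ k)^-1 = 2 - 2 * (2 ^+ K)^-1 :> R.
  by move=> ->; rewrite lerBlDr lerDl mulr_ge0// invr_ge0 exprn_ge0.
elim: K => [|K IH]; first by rewrite big_ord0 expr0 invr1; lra.
rewrite big_ord_recr/= IH exprS invfM; lra.
Qed.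

(** [320 = 64 * 5]: in units of [s sqrt m psi], the levels contribute [2 * 2] by the geometric
    series and the last level [1]. *)
Lemma B_le_off_bad_event {R : realType} d (T : measurableType d)
    (P : probability T R) (n m N K : nat) (X : 'I_N -> {RV P >-> n.-tuple R})
    (r psi theta kap C0 b : R) w :
  1 <= r -> 0 < psi -> 0 < theta -> 1 <= kap -> 0 < C0 -> (0 < m)%N -> (m <= N)%N ->
  (64 ^ K <= m)%N -> 1 <= ln (2 * N%:R / (theta * m%:R)) ->
  m%:R * ln (2 * N%:R / (theta * m%:R)) `^ (2 / r) <= theta ^+ 2 * n%:R ->
  (forall i, enorm (tuple_row (X i w)) <= b) ->
  ~ bad_event m K X r psi theta kap C0 w ->
  B_ m (fun i => tuple_row (X i w)) ^+ 2
    <= 320 * C0 * (kap * psi * theta * Num.sqrt n%:R)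
       * Num.sqrt (b ^+ 2 + B_ m (fun i => tuple_row (X i w)) ^+ 2).
Proof.
move=> r1 psi0 theta0 kap1 c0 m0 mN Km L1 hm Xb nbad.
set L := ln _ in L1 hm.
have r0 : 0 < r := lt_le_trans ltr01 r1.
have m0R : 0 < m%:R :> R by rewrite ltr0n.
have sq0 : 0 < Num.sqrt m%:R :> R by rewrite sqrtr_gt0.
have kap0 : 0 < kap := lt_le_trans ltr01 kap1.
have L0 : 0 < L := lt_le_trans ltr01 L1.
have Lp := powR_gt0 r^-1 L0.
(* The square root of the hypothesis on [m]. *)
have mL : Num.sqrt m%:R * L `^ r^-1 <= theta * Num.sqrt n%:R.
  rewrite -(@ler_pXn2r _ 2)// ?nnegrE ?mulr_ge0 ?sqrtr_ge0 ?powR_ge0 ?(ltW theta0)//.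
  rewrite !exprMn !sqr_sqrtr ?ler0n//.
  by rewrite -powR_mulrn ?powR_ge0// -powRrM mulrC [r^-1 * _]mulrC mulrC.
set A := Num.sqrt (_ + _); have A0 : 0 <= A by exact: sqrtr_ge0.
pose s := scale_tail m N r theta kap C0.
have s0 : 0 < s by rewrite /s /scale_tail !mulr_gt0.
pose tk (k : nat) : R := s * 2 ^+ k / lam m k.+1 * psi.
pose tt : R := s * Num.sqrt m%:R / 1 * psi.
have tkE k : tk k = s * Num.sqrt m%:R * psi * (2 ^+ k)^-1.
  rewrite /tk /lam (_ : 4 ^+ k = 2 ^+ k * 2 ^+ k); last first.
    by rewrite -exprMn; congr (_ ^+ _); lra.
  by field; rewrite !gt_eqF// exprn_gt0.
have t0 : 0 <= s * Num.sqrt m%:R * psi by rewrite mulr_ge0 ?(ltW psi0)// mulr_ge0 ?(ltW s0) ?(ltW sq0).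
have := @sqr_B_le_of_nets R n N m K.+1 (fun i => tuple_row (X i w)) m0 mN b tt tk Xb.
rewrite -/A => /(_ _ _ _ _ _ _)/le_trans; apply => //.
- by move=> k; rewrite tkE mulr_ge0// invr_ge0 exprn_ge0.
- by rewrite /tt divr1.
- by move=> k kK; exact: (level_size_gt0 Km kK).
- by move=> k; rewrite ltnS => kK; exact: (sqrt_level_size_le m0 Km R kK).
- move=> k kK p pg; apply: not_level_bad pg => bad.
  by apply: nbad; left; rewrite (bigD1 (Ordinal kK))//=; left.
- by move=> p pg; apply: not_level_bad pg => bad; apply: nbad; right.
rewrite ler_wpM2r//.
have -> : \sum_(k < K.+1) 2 * tk k =
    2 * (s * Num.sqrt m%:R * psi) * \sum_(k < K.+1) (2 ^+ k)^-1.
  by rewrite mulr_sumr; apply: eq_bigr => k _; rewrite tkE mulrA.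
have := @sum_geometric_half R K.+1; set S := \sum_(k < _) _ => S2.
rewrite /tt divr1.
have : s * Num.sqrt m%:R * psi <= C0 * (kap * psi * theta * Num.sqrt n%:R).
  rewrite /s /scale_tail -/L.
  have -> : C0 * kap * L `^ r^-1 * Num.sqrt m%:R * psi =
      C0 * kap * psi * (Num.sqrt m%:R * L `^ r^-1) by ring.
  have -> : C0 * (kap * psi * theta * Num.sqrt n%:R) =
      C0 * kap * psi * (theta * Num.sqrt n%:R) by ring.
  by rewrite ler_pM2l// !mulr_gt0.
have : s * Num.sqrt m%:R * psi * S <= s * Num.sqrt m%:R * psi * 2 by rewrite ler_wpM2l.
lra.
Qed.

(** If [be > a^2 + a e], then [be^2 > a^2 be + a e be >= a^2 be + a^2 e^2], against the square of
    the hypothesis. *)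
Lemma self_bound_sqrt {R : realType} (be a e : R) : 0 <= be -> 0 <= a -> 0 <= e ->
  be <= a * Num.sqrt (e ^+ 2 + be) -> be <= a ^+ 2 + a * e.
Proof.
move=> be0 a0 e0 h; rewrite leNgt; apply/negP => hlt.
have s0 : 0 <= e ^+ 2 + be by rewrite addr_ge0// sqr_ge0.
have : be ^+ 2 <= a ^+ 2 * (e ^+ 2 + be).
  rewrite -[X in _ * X](sqr_sqrtr s0) -exprMn lerXn2r ?nnegrE//.
  by rewrite mulr_ge0// sqrtr_ge0.
have ae0 : 0 <= a * e by exact: mulr_ge0.
have h1 : a * e * (a * e) <= a * e * be.
  by rewrite ler_wpM2l//; apply: le_trans (ltW hlt); rewrite lerDr sqr_ge0.
have be1 : 0 < be by apply: le_lt_trans hlt; rewrite addr_ge0// sqr_ge0.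
have : (a ^+ 2 + a * e) * be < be * be by rewrite ltr_pM2r.
nra.
Qed.

Theorem theorem3p2 (R : realType) :
  exists C c : R, [/\ 0 < C, 0 < c &
  forall (d : measure_display) (T : measurableType d) (P : probability T R)
    (n m N : nat) (r : R) (X : 'I_N -> {RV P >-> n.-tuple R})
    (psi theta K K' : R),
  (1 <= n)%N -> (1 <= m)%N -> (m <= N)%N ->
  1 <= r -> r <= 2 ->
  independent_RV X ->
  (forall i, psi_vector P r (fun w => tuple_row (X i w))) ->
  psi%:E = \big[maxe/-oo%E]_(i < N)
             psi_vnorm P r (fun w => tuple_row (X i w)) ->
  0 < theta -> theta < 1 / 4 ->
  1 <= K -> 1 <= K' ->
  m%:R * ln (2 * N%:R / (theta * m%:R)) `^ (2 / r) <= theta ^+ 2 * n%:R ->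
  let xi := psi * K + K' in
  (P [set w | (B_ m (fun i => tuple_row (X i w)) ^+ 2
                 <= C * xi ^+ 2 * theta * n%:R)%R]
   >= 1 - (expR (- (c * K `^ r * Num.sqrt m%:R
                    * ln (2 * N%:R / (theta * m%:R)))))%:E
      - P [set w | (\big[Num.max/0]_(i < N) enorm (tuple_row (X i w))
                      >= K' * Num.sqrt n%:R)%R])%E].
Proof.
(* The constants are named through equations to keep large numerals out of the terms. *)
have [C0 C0E] : exists C0 : R, C0 = 515 * 512 by eexists.
have C00 : 0 < C0 by rewrite C0E; lra.
have [c0 c0E] : exists c0 : R, c0 = 320 * C0 by eexists.
have c00 : 0 < c0 by rewrite c0E; lra.
(* The terms [a^2] and [a e] of [self_bound_sqrt], with [a = c0 * ka], contribute [c0^2] and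
   [c0]. *)
exists (c0 ^+ 2 + c0), 1; split => //; first by rewrite addr_gt0// exprn_gt0.
move=> d T P n m N r X psi theta K K' n0 m0 mN r1 r2 indX psiX psiE.
move=> theta0 theta4 K1 K'1 hm; cbv zeta; set xi := psi * K + K'.
have N0 : (0 < N)%N := leq_trans m0 mN.
have psi0 : 0 <= psi.
  rewrite -lee_fin psiE; apply: le_trans (psi_vnorm_ge0 (X (Ordinal N0)) r n0) _.
  exact: (le_bigmax -oo%E (fun i => psi_vnorm P r (fun w => tuple_row (X i w)))).
have K0 : 0 < K := lt_le_trans ltr01 K1.
(* With the increment [K^-1], the scale is positive and above the infimum, and
   [psi' * K = psi * K + 1 <= xi]. *)
pose psi' := psi + K^-1.
have psi'0 : 0 < psi' by rewrite /psi' ltr_wpDl// invr_gt0.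
have vn i : (psi_vnorm P r (fun w => tuple_row (X i w)) < psi'%:E)%E.
  apply: (@le_lt_trans _ _ psi%:E); last by rewrite lte_fin ltrDl invr_gt0.
  rewrite psiE.
  exact: (le_bigmax -oo%E (fun i => psi_vnorm P r (fun w => tuple_row (X i w)))).
have psiX' i := psi_vnorm_lt_integral r1 (vn i).
have centX i := integral_dotp_eq0 r1 psi'0 (vn i) (proj1 (psiX i)).
have m0R : 0 < m%:R :> R by rewrite ltr0n.
have L1 : 1 <= ln (2 * N%:R / (theta * m%:R)) :> R.
  rewrite -[leLHS]expRK ler_ln ?posrE ?expR_gt0//; last first.
    by rewrite divr_gt0 ?mulr_gt0 ?ltr0n.
  apply: (le_trans expR1_le4); rewrite ler_pdivlMr ?mulr_gt0//.
  have : m%:R <= N%:R :> R by rewrite ler_nat.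
  have : theta * m%:R <= 4^-1 * m%:R by rewrite ler_pM2r//; lra.
  have := m0R; lra.
have /andP[Km mK] := trunc_log_bounds (isT : 1 < 64)%N m0.
set k := trunc_log 64 m in Km mK.
have bad := bad_event_le indX r1 r2 psi'0 psiX' centX m0 mN Km mK theta0 theta4 K1 L1 C0E.
set Bad := bad_event _ _ _ _ _ _ _ _ in bad.
have mBad : measurable Bad by exact: measurable_bad_event.
set M := [set w | _ <= _]; set G := [set w | _ <= _].
have mrow i : measurable_row (fun w => tuple_row (X i w)).
  exact: measurable_tuple_row.
have mM : measurable M.
  apply: measurable_set_le => //; apply: measurable_bigmaxr => i.
  exact: measurable_enorm.
have tau0 : 0 <= (c0 ^+ 2 + c0) * xi ^+ 2 * theta * n%:R.
  rewrite mulr_ge0// mulr_ge0 ?(ltW theta0)// mulr_ge0 ?sqr_ge0//.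
  by rewrite addr_ge0 ?sqr_ge0// ltW.
have mG : measurable G by exact: measurable_B_le.
have sub : ~` G `<=` Bad `|` M.
  move=> w /= wG; apply: contrapT => /not_orP[wB wM]; apply: wG.
  have Xb i : enorm (tuple_row (X i w)) <= K' * Num.sqrt n%:R.
    apply: ltW; rewrite ltNge; apply/negP => h; apply: wM; apply: le_trans h _.
    exact: (le_bigmax 0 (fun i => enorm (tuple_row (X i w)))).
  have := B_le_off_bad_event r1 psi'0 theta0 K1 C00 m0 mN Km L1 hm Xb wB.
  set be := B_ _ _ ^+ 2; set ka := K * psi' * theta * _ => hbe.
  have be0 : 0 <= be by exact: sqr_ge0.
  have kap : K * psi' = psi * K + 1 by rewrite /psi' mulrDr mulfV ?gt_eqF// mulrC.
  have q0 : 0 <= Num.sqrt n%:R :> R by exact: sqrtr_ge0.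
  have q2 : Num.sqrt n%:R * Num.sqrt n%:R = n%:R :> R by rewrite -expr2 sqr_sqrtr ?ler0n.
  have pK0 : 0 <= psi * K by rewrite mulr_ge0// ltW.
  have ka0 : 0 <= ka by rewrite /ka !mulr_ge0// ltW.
  have e0 : 0 <= K' * Num.sqrt n%:R by rewrite mulr_ge0// (le_trans ler01).
  have a0 : 0 <= c0 * ka by rewrite mulr_ge0// ltW.
  rewrite -c0E in hbe.
  apply: le_trans (self_bound_sqrt be0 a0 e0 hbe) _.
  (* The square carries [theta^2], of which one factor is bounded by [1]; the mixed term carries
     exactly the [theta] of the claim. *)
  have -> : (c0 * ka) ^+ 2 + c0 * ka * (K' * Num.sqrt n%:R) =
    (c0 ^+ 2 * (theta * (psi * K + 1) ^+ 2) + c0 * ((psi * K + 1) * K'))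
      * theta * (Num.sqrt n%:R * Num.sqrt n%:R).
    by rewrite /ka kap; ring.
  rewrite q2 ler_wpM2r ?ler0n// ler_wpM2r ?(ltW theta0)// [leRHS]mulrDl.
  have xi0 : 0 <= xi by rewrite /xi addr_ge0// (le_trans ler01).
  have k1 : psi * K + 1 <= xi by rewrite /xi lerD2l.
  have k2 : (psi * K + 1) ^+ 2 <= xi ^+ 2.
    by rewrite lerXn2r// nnegrE addr_ge0.
  apply: lerD; rewrite ler_wpM2l ?sqr_ge0 ?(ltW c00)//.
    apply: le_trans k2; apply: ler_piMl; first exact: sqr_ge0.
    by apply: ltW; apply: lt_trans theta4 _; lra.
  by rewrite expr2; apply: ler_pM => //; rewrite ?addr_ge0 ?(le_trans ler01 K'1)// /xi lerDr.
have PC : (P (~` G) <= (expR (- (1 * K `^ r * Num.sqrt m%:R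
      * ln (2 * N%:R / (theta * m%:R)))))%:E + P M)%E.
  apply: (@le_trans _ _ (P (Bad `|` M))).
    by apply: le_measure; rewrite ?inE//; [exact: measurableC|exact: measurableU].
  apply: (le_trans (measureU2 P mBad mM)); rewrite leeD2r//.
  by rewrite mul1r -[K `^ r * _ * _]mulrAC.
have PG : P G = (1 - P (~` G))%E by rewrite -probability_setC ?setCK//; exact: measurableC.
rewrite PG -addeA -oppeD ?fin_num_adde_defr//.
by rewrite leeD2l// leeN2.
Qed.
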